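(* For every positive integer $n$ there exists a free $\mathbb{Z}_2$-space $X_n$ such that $h(X_n) = n$ and $\mathrm{coind}(X_n) = 1$.
   Context: $\mathbb{Z}_2$ is the cyclic group of order 2 with generator $\tau$. Groups act on spaces from the right unless otherwise stated. An action of a group $\Gamma$ on a space $X$ is called free if every $x \in X$ has a neighborhood $U$ such that $U\gamma \cap U = \emptyset$ for all $\gamma \in \Gamma \setminus \{e_\Gamma\}$; a free $\mathbb{Z}_2$-space is a topological space with a free $\mathbb{Z}_2$-action. For a $\mathbb{Z}_2$-space $X$, $\overline{X}$ denotes its orbit space. $S^m_a$ denotes the $m$-dimensional sphere with the antipodal $\mathbb{Z}_2$-action. A $\mathbb{Z}_2$-map is a continuous $\mathbb{Z}_2$-equivariant map. For a free $\mathbb{Z}_2$-space $X$, the coindex of $X$ is $$\mathrm{coind}(X) = \sup\{ m \geq 0 \mid \text{there is a } \mathbb{Z}_2\text{-map from } S^m_a \text{ to } X\},$$ and the Stiefel-Whitney height of $X$ is $$h(X) = \sup\{ m \geq 0 \mid w_1(X)^m \neq 0\},$$ where $w_1(X) \in H^1(\overline{X};\mathbb{Z}_2)$ (singular cohomology) is the first Stiefel-Whitney class of the double cover $X \to \overline{X}$ (under $H^1(\overline{X};\mathbb{Z}_2) \cong \mathrm{Hom}(H_1(\overline{X}),\mathbb{Z}_2)$, it is the homomorphism that is $0$ on the class of a loop if the loop lifts to a loop in $X$, and $1$ otherwise). *)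

(* Defs.v *)
From HB Require Import structures.
From mathcomp Require Import all_boot all_order all_algebra.
From mathcomp Require Import generic_quotient ring_quotient.
From mathcomp Require Import all_classical all_reals all_analysis.

Set Implicit Arguments.
Unset Strict Implicit.
Unset Printing Implicit Defensive.

Import Order.TTheory GRing.Theory Num.Theory.
Import numFieldNormedType.Exports.

Local Open Scope classical_set_scope.
Local Open Scope ring_scope.
Local Open Scope quotient_scope.

(* The group Z_2 is the additive group of ['Z_2], with generator tau = 1.  As
   Z_2 is discrete, the action is continuous iff each translation is. *)
Record Z2space := MkZ2space {
  Z2carrier :> topologicalType;
  Z2act : Z2carrier -> 'Z_2 -> Z2carrier;
  Z2act0 : forall x, Z2act x 0 = x;
  Z2actD : forall x g h, Z2act x (g + h) = Z2act (Z2act x g) h;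
  Z2act_continuous : forall g, continuous (Z2act^~ g) }.

Definition free_action (X : Z2space) : Prop :=
  forall x : X, exists2 U : set X, nbhs x U &
    forall g : 'Z_2, g != 0 -> (@Z2act X ^~ g @` U) `&` U = set0.

Definition Z2map (X Y : Z2space) (f : X -> Y) : Prop :=
  continuous f /\ forall x g, f (Z2act x g) = Z2act (f x) g.

Section OrbitSpace.
Variable X : Z2space.

Definition orbit_rel (x y : X) : bool := [exists g : 'Z_2, y == Z2act x g].

Lemma orbit_equiv_class : equiv_class_of orbit_rel.
Proof.
split=> [x|x y|y x z].
- by apply/existsP; exists 0; rewrite Z2act0.
- apply/idP/idP => /existsP[g /eqP->]; apply/existsP; exists (- g);
    by rewrite -Z2actD subrr Z2act0.
- move=> /existsP[g /eqP->] /existsP[h /eqP->].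
  by apply/existsP; exists (g + h); rewrite Z2actD.
Qed.

Canonical orbit_equiv := EquivRelPack orbit_equiv_class.

Definition orbit_space : topologicalType :=
  quotient_topology {eq_quot orbit_equiv}.

Definition orbit_proj (x : X) : orbit_space := \pi_({eq_quot orbit_equiv})%qT x.

End OrbitSpace.

Section Sphere.
Variables (R : realType) (m : nat).

Definition sphere_set : set 'rV[R]_m.+1 := [set x | \sum_i x 0 i ^+ 2 = 1].
Arguments sphere_set : clear implicits.

Definition sphere : topologicalType := set_type sphere_set.

Definition antipode_val (x : sphere) (g : 'Z_2) : 'rV[R]_m.+1 :=
  (-1) ^+ (g : nat) *: set_val x.

Lemma antipode_subproof x g : antipode_val x g \in sphere_set.
Proof.
apply/mem_set; rewrite /sphere_set /=.
rewrite -[RHS](set_mem (valP x)); apply: eq_bigr => i _.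
by rewrite mxE exprMn -exprM mulnC exprM sqrrN expr1n expr1n mul1r.
Qed.

Definition antipode (x : sphere) (g : 'Z_2) : sphere :=
  exist _ (antipode_val x g) (antipode_subproof x g).

Lemma antipode0 x : antipode x 0 = x.
Proof. by apply: val_inj; rewrite /= /antipode_val expr0 scale1r. Qed.

Lemma antipodeD x g h : antipode x (g + h) = antipode (antipode x g) h.
Proof.
apply: val_inj; rewrite /= /antipode_val /= scalerA -exprD.
congr (_ *: _); rewrite -[LHS]signr_odd -[RHS]signr_odd; congr (_ ^+ _).
by move: g h; do 2!case=> [[|[|?]] ?].
Qed.

Lemma antipode_continuous g : continuous (antipode^~ g).
Proof.
apply: continuous_comp_initial => x.
have vc := @initial_continuous _ _ (set_val : sphere_set -> _) x.
have -> : set_val \o antipode^~ g =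
    fun y : sphere => (-1) ^+ (g : nat) *: (set_val y : 'rV[R]_m.+1).
  by apply/funext => y; rewrite /= set_valE.
exact: (@cvgZl_tmp _ _ _ _ (nbhs_filter (x : sphere)) _
  (set_val : sphere -> 'rV[R]_m.+1) _ vc).
Qed.

Definition sphere_a : Z2space :=
  MkZ2space antipode0 antipodeD antipode_continuous.

End Sphere.

Section StandardSimplex.
Variable R : realType.

Definition simplex_set n : set 'rV[R]_n.+1 :=
  [set x | (forall i, 0 <= x 0 i) /\ \sum_i x 0 i = 1].
Arguments simplex_set : clear implicits.

Definition simplex n : topologicalType := set_type (simplex_set n).

Lemma vertex_subproof n (i : 'I_n.+1) : delta_mx 0 i \in simplex_set n.
Proof.
apply/mem_set; split=> [j|]; first by rewrite mxE ler0n.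
rewrite (bigD1 i) //= big1 ?addr0 ?mxE ?eqxx// => j ji.
by rewrite mxE (negbTE ji) andbF.
Qed.

Definition vertex n (i : 'I_n.+1) : simplex n :=
  exist _ (delta_mx 0 i) (vertex_subproof i).

Section SimplexMap.
Variables (m n : nat) (f : 'I_m.+1 -> 'I_n.+1).

(* The affine map of simplices that sends vertex i to vertex (f i). *)
Definition simplex_map_val (x : simplex m) : 'rV[R]_n.+1 :=
  \sum_i set_val x 0 i *: delta_mx 0 (f i).

Lemma simplex_map_subproof x : simplex_map_val x \in simplex_set n.
Proof.
have [x0 x1] := set_mem (valP x); apply/mem_set; split=> [j|].
  rewrite summxE; apply: sumr_ge0 => i _.
  by rewrite !mxE mulr_ge0 ?ler0n//; exact: x0.
under eq_bigr do rewrite summxE.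
rewrite exchange_big /= -[RHS]x1; apply: eq_bigr => i _.
rewrite (bigD1 (f i)) //= big1 ?addr0 => [|j ji].
  by rewrite !mxE !eqxx mulr1.
by rewrite !mxE (negbTE ji) mulr0.
Qed.

Definition simplex_map (x : simplex m) : simplex n :=
  exist _ (simplex_map_val x) (simplex_map_subproof x).

Lemma simplex_map_continuous : continuous simplex_map.
Proof.
apply: continuous_comp_initial.
have -> : set_val \o simplex_map = simplex_map_val.
  by apply/funext => y; rewrite /= set_valE.
rewrite /simplex_map_val.
apply: (@continuous_big 'rV[R]_n.+1) => [|i _ x]; first exact: add_continuous.
have vc := @initial_continuous _ _ (set_val : simplex_set m -> _) x.
apply: (@cvgZr_tmp _ _ _ _ (nbhs_filter (x : simplex m))).
exact: (cvg_comp _ _ vc (@coord_continuous _ _ _ 0 i _)).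
Qed.

End SimplexMap.

Lemma simplex_map_comp l m n (f : 'I_m.+1 -> 'I_n.+1) (g : 'I_l.+1 -> 'I_m.+1) :
  simplex_map f \o simplex_map g = simplex_map (f \o g).
Proof.
apply/funext => x; apply: val_inj; rewrite /= /simplex_map_val /=.
under eq_bigr do rewrite /simplex_map_val summxE scaler_suml.
rewrite exchange_big /=; apply: eq_bigr => i _.
rewrite (bigD1 (g i)) //= big1 ?addr0 => [|j ji].
  by rewrite !mxE !eqxx mulr1.
by rewrite !mxE (negbTE ji) mulr0 scale0r.
Qed.

End StandardSimplex.

Section SingularCohomology.
Variables (R : realType) (X : topologicalType) (A : comNzRingType).

Definition singular n := {s : simplex R n -> X | continuous s}.

Lemma singular_comp_subproof m n (s : singular n) (f : 'I_m.+1 -> 'I_n.+1) :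
  continuous (sval s \o @simplex_map R m n f).
Proof.
move=> x; apply: continuous_comp; first exact: simplex_map_continuous.
exact: proj2_sig s _.
Qed.

Definition singular_comp m n (s : singular n) (f : 'I_m.+1 -> 'I_n.+1) :
    singular m :=
  exist _ (sval s \o @simplex_map R m n f) (@singular_comp_subproof m n s f).

Lemma singular_compA l m n (s : singular n) (f : 'I_m.+1 -> 'I_n.+1)
    (g : 'I_l.+1 -> 'I_m.+1) :
  singular_comp (singular_comp s f) g = singular_comp s (f \o g).
Proof. by apply: eq_exist; rewrite /= -compA simplex_map_comp. Qed.

(* C^n(X; A) = Hom(C_n(X), A), a cochain being given by its values on the
   singular simplices, which are a basis of C_n(X). *)
Definition cochain n := singular n -> A.

HB.instance Definition _ n := GRing.Zmodule.on (cochain n).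

Definition coboundary n (c : cochain n) : cochain n.+1 :=
  fun s => \sum_(i < n.+2) (-1) ^+ i * c (singular_comp s (lift i)).

Lemma coboundaryB n (c d : cochain n) :
  coboundary (c - d) = coboundary c - coboundary d.
Proof.
apply/funext => s; rewrite /coboundary !fctE -sumrB.
by apply: eq_bigr => i _; rewrite mulrBr.
Qed.

Lemma coboundary0 n : coboundary (0 : cochain n) = 0.
Proof. by rewrite -(subrr 0) coboundaryB !subrr. Qed.

Definition is_cocycle n (c : cochain n) : bool := `[< coboundary c = 0 >].

Lemma is_cocycle_closed n : zmod_closed (@is_cocycle n).
Proof.
split=> [|c d /asboolP c0 /asboolP d0]; apply/asboolP.
  exact: coboundary0.
by rewrite coboundaryB c0 d0 subrr.
Qed.

HB.instance Definition _ n :=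
  GRing.isZmodClosed.Build (cochain n) (@is_cocycle n) (@is_cocycle_closed n).

Record cocycle n := Cocycle {
  cocycle_val :> cochain n;
  cocycleP : cocycle_val \in @is_cocycle n }.

HB.instance Definition _ n := [isSub for @cocycle_val n].
HB.instance Definition _ n := [Choice of cocycle n by <:].
HB.instance Definition _ n := [SubChoice_isSubZmodule of cocycle n by <:].

Definition is_coboundary n : cocycle n -> bool :=
  match n with
  | 0 => fun c => c == 0
  | n'.+1 => fun c => `[< exists b : cochain n', coboundary b = c >]
  end.

Lemma is_coboundary_closed n : zmod_closed (@is_coboundary n).
Proof.
case: n => [|n]; split=> [|c d].
- exact: eqxx.
- by move=> /eqP-> /eqP->; rewrite /is_coboundary/= unfold_in subrr.
- by apply/asboolP; exists 0; rewrite coboundary0.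
- move=> /asboolP[b bc] /asboolP[b' bd]; apply/asboolP; exists (b - b').
  by rewrite coboundaryB bc bd.
Qed.

HB.instance Definition _ n :=
  GRing.isZmodClosed.Build (cocycle n) (@is_coboundary n)
    (@is_coboundary_closed n).

Definition coboundaries n : zmodClosed (cocycle n) :=
  GRing.ZmodClosed.clone _ (@is_coboundary n) _.

Definition cohomology n : zmodType := Quotient.quot (coboundaries n).

Definition cohomology_class n (c : cocycle n) : cohomology n :=
  \pi_(Quotient.quot (coboundaries n)) c.

Definition representative n (u : cohomology n) : cocycle n := repr u.

Definition front p q (i : 'I_p.+1) : 'I_(p + q).+1 := inord i.
Definition back p q (j : 'I_q.+1) : 'I_(p + q).+1 := inord (p + j).

Definition cup_cochain p q (a : cochain p) (b : cochain q) : cochain (p + q) :=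
  fun s => a (singular_comp s (@front p q)) * b (singular_comp s (@back p q)).

(* A special case of the Leibniz rule. *)
Lemma cup_cocycle_subproof p q (a : cocycle p) (b : cocycle q) :
  cup_cochain a b \in @is_cocycle (p + q).
Proof.
case: a b => a /asboolP a0 [b /asboolP b0] /=; apply/asboolP/funext => s.
rewrite /coboundary [RHS]/=.
pose sub m (f : nat -> nat) : singular m :=
  singular_comp s (fun i : 'I_m.+1 => inord (f i)).
have eqsub m f g : (forall i, (i <= m)%N -> f i = g i) -> sub m f = sub m g.
  move=> fg; rewrite /sub; congr singular_comp.
  by apply/funext => i; rewrite fg// -ltnS.
have sA : \sum_(i < p.+2) (-1) ^+ i * a (sub p (bump i)) = 0.
  transitivity (coboundary a (sub p.+1 id)); last by rewrite a0.
  by apply: eq_bigr => i _; congr (_ * a _); rewrite /sub singular_compA.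
have sB : \sum_(i < q.+2) (-1) ^+ i * b (sub q (fun j => p + bump i j)%N) = 0.
  transitivity (coboundary b (sub q.+1 (addn p))); last by rewrite b0.
  by apply: eq_bigr => i _; congr (_ * b _); rewrite /sub singular_compA.
pose T (i : nat) : A := (-1) ^+ i *
  (a (sub p (bump i)) * b (sub q (fun j => bump i (p + j)%N))).
have bump_lt k l : (l < (p + q).+1)%N -> (bump k l < (p + q).+2)%N.
  by move=> lpq; rewrite ltnS (leq_trans _ lpq)// /bump; case: (k <= l)%N.
transitivity (\sum_(i < (p.+1 + q.+1)%N) T i).
  rewrite addSn addnS; apply: eq_bigr => i _.
  congr (_ * (a _ * b _)); rewrite singular_compA;
    congr singular_comp; apply/funext => j; apply: val_inj => /=.
    have jn : (j < (p + q).+1)%N.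
      by rewrite (leq_trans (ltn_ord j))// ltnS leq_addr.
    by rewrite !inordK// bump_lt.
  have jn : (p + j < (p + q).+1)%N by rewrite ltnS leq_add2l -ltnS.
  by rewrite !inordK// bump_lt.
pose a0' := a (sub p id); pose b0' := b (sub q (fun j => p + j.+1)%N).
have fa0 i : (p < i)%N -> a (sub p (bump i)) = a0'.
  move=> pi; congr a; apply: eqsub => j jp.
  by rewrite /bump leqNgt (leq_ltn_trans jp pi).
rewrite big_split_ord /=.
move: sA; rewrite big_ord_recr /= fa0// => sA.
move: sB; rewrite big_ord_recl /= => sB.
have -> : \sum_(i < p.+1) T i = - ((-1) ^+ p.+1 * a0') * b0'.
  move/eqP: sA; rewrite addr_eq0 => /eqP <-; rewrite mulr_suml.
  apply: eq_bigr => i _; rewrite /T mulrA; congr (_ * _ * b _).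
  apply: eqsub => j _; rewrite /bump addnS.
  by rewrite (leq_trans (leq_ord i) (leq_addr _ _)).
have -> : \sum_(i < q.+1) T (p.+1 + i)%N = - ((-1) ^+ p * a0' * b0').
  have -> : b0' = - \sum_(i < q.+1) (-1) ^+ (bump 0 i) *
      b (sub q (fun j => p + bump (bump 0 i) j)%N).
    move/eqP: sB; rewrite addr_eq0 expr0 mul1r => /eqP <-.
    by congr b; apply: eqsub.
  rewrite mulrN opprK mulr_sumr; apply: eq_bigr => i _.
  rewrite /T fa0 ?leq_addr// addSnnS exprD -!mulrA; congr (_ * _).
  rewrite mulrCA; congr (_ * (_ * b _)).
  by apply: eqsub => j _; rewrite /bump /= add1n leq_add2l addnCA.
by rewrite exprS mulN1r !mulNr opprK subrr.
Qed.

Definition cup_cocycle p q (a : cocycle p) (b : cocycle q) : cocycle (p + q) :=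
  Cocycle (cup_cocycle_subproof a b).

(* The class of the product does not depend on the representatives. *)
Definition cup p q (u : cohomology p) (v : cohomology q) : cohomology (p + q) :=
  cohomology_class (cup_cocycle (representative u) (representative v)).

Lemma one_cocycle_subproof : (cst 1 : cochain 0) \in @is_cocycle 0.
Proof.
apply/asboolP/funext => s; rewrite /coboundary !big_ord_recr big_ord0 /=.
by rewrite add0r expr0 expr1 !mulr1 subrr.
Qed.

Definition cohomology1 : cohomology 0 :=
  cohomology_class (Cocycle one_cocycle_subproof).

Fixpoint cup_power (u : cohomology 1) (m : nat) : cohomology m :=
  match m with
  | 0 => cohomology1
  | m'.+1 => cup u (cup_power u m')
  end.

End SingularCohomology.

Arguments singular : clear implicits.
Arguments cochain : clear implicits.
Arguments cocycle : clear implicits.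
Arguments coboundaries : clear implicits.
Arguments cohomology : clear implicits.

Section Loops.
Variables (R : realType) (T : topologicalType).

(* Loops are singular 1-simplices with equal endpoints, hence 1-cycles. *)
Definition is_loop (s : singular R T 1) : Prop :=
  sval s (vertex R ord0) = sval s (vertex R ord_max).

(* The image of a class under H^1(T; A) -> Hom(H_1(T), A), at the homology
   class of a loop. *)
Definition eval_loop (A : comNzRingType) (u : cohomology R T A 1)
    (s : singular R T 1) : A :=
  cocycle_val (representative u) s.

Lemma coboundary_loop (A : comNzRingType) (b : cochain R T A 0) s :
  is_loop s -> coboundary b s = 0.
Proof.
move=> sl; rewrite /coboundary !big_ord_recr big_ord0 /= add0r expr0 expr1.
rewrite mul1r mulN1r; apply/eqP; rewrite subr_eq0; apply/eqP; congr b.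
apply: eq_exist; apply/funext => x /=.
have x1 : set_val x 0 0 = 1.
  by have [_] := set_mem (valP x); rewrite big_ord_recr big_ord0 /= add0r;
    rewrite (ord1 ord_max).
have fE (i : 'I_2) (f : 'I_1 -> 'I_2) : f 0 = i -> simplex_map f x = vertex R i.
  move=> <-; apply: val_inj => /=.
  by rewrite /simplex_map_val big_ord_recr big_ord0 /= add0r (ord1 ord_max) x1
    scale1r.
rewrite (@fE ord_max); last exact: val_inj.
by rewrite (@fE ord0)//; exact: val_inj.
Qed.

Lemma eval_loop_class (A : comNzRingType) (c : cocycle R T A 1) s :
  is_loop s -> eval_loop (cohomology_class c) s = cocycle_val c s.
Proof.
move=> sl; rewrite /eval_loop /representative.
have : (c - repr (cohomology_class c)) \in coboundaries R T A 1.
  by rewrite Quotient.idealrBE reprK.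
move=> /asboolP[b bE]; apply/esym/eqP; rewrite -subr_eq0.
by have := coboundary_loop b sl; rewrite bE => <-.
Qed.

End Loops.

Section StiefelWhitney.
Variables (R : realType) (X : Z2space).

Definition lifts_to_loop (s : singular R (orbit_space X) 1) : Prop :=
  exists2 t : singular R X 1,
    (forall x, orbit_proj (sval t x) = sval s x) & is_loop t.

Definition is_sw1 (w : cohomology R (orbit_space X) 'F_2 1) : Prop :=
  forall s, is_loop s -> eval_loop w s = if `[< lifts_to_loop s >] then 0 else 1.

(* For a free Z_2-space there is exactly one such class, as
   H^1(-; Z_2) = Hom(H_1(-), Z_2) and H_1 is generated by loops; the default
   value 0 is then not used. *)
Definition sw1 : cohomology R (orbit_space X) 'F_2 1 := xget 0 is_sw1.

(* Suprema of sets of naturals are taken in the extended reals, so that they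
   may be infinite. *)
Definition sw_height : \bar R :=
  ereal_sup [set (m%:R)%:E | m in [set m | cup_power sw1 m != 0]].

Definition coind : \bar R :=
  ereal_sup [set (m%:R)%:E | m in
    [set m | exists f : sphere_a R m -> X, Z2map f]].

End StiefelWhitney.

(* Main.v *)
Require Import Defs.
From mathcomp Require Import all_boot all_order all_algebra.
From mathcomp Require Import generic_quotient ring_quotient zify ring lra.
From mathcomp Require Import all_classical all_reals all_analysis.

Set Implicit Arguments.
Unset Strict Implicit.
Unset Printing Implicit Defensive.

Import Order.TTheory GRing.Theory Num.Theory.
Import numFieldNormedType.Exports.

Local Open Scope classical_set_scope.
Local Open Scope ring_scope.

(** The tower starts with two points exchanged by the involution.  Given X with
    involution tau, let Y be the quotient of X * (R^2 minus the origin) by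
    s (x, z) = (tau x, conj z) and z |-> -z, with the involution induced by
    r (x, z) = (x, i z); thus Y is, up to homotopy, a circle bundle over the
    orbit space of X.

    If S^m -> Y is equivariant with m > 1, its restriction to a hemisphere
    gives a map of the disc to Y that is odd on the boundary.  It lifts to a
    pair (phi, zeta), and along the boundary either phi is odd, which produces
    such a disc in X, or zeta is multiplied by a constant sign times i under
    the antipode; applying the antipode twice then gives zeta = -zeta.  Two
    points admit no odd disc, hence the coindex of every later stage is 1.

    If w and y are the Stiefel-Whitney classes of Y and X, the latter pulled
    back to the orbit space of Y, then w (w + y) = 0, so w^(k+1) = w y^k and
    the height grows by at most one.  It does grow: the equivariant map
    x |-> [x, (1, 1)] from X to Y is homotopic to x |-> [x, (1, 0)], which is
    constant on orbits.  If w^(n+1) is the coboundary of b and e is a 0-cochain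
    of Y with coboundary w, then e w^n + b is a cocycle of Y; comparing its
    pullbacks along the two maps, and adding the translate by tau, shows that
    y^n is a coboundary. *)

(** * Involutions, sheets and orbit spaces *)

Lemma Z2_cases (g : 'Z_2) : g = 0 \/ g = 1.
Proof. by case: g => [[|[|//]] ?]; [left|right]; exact: val_inj. Qed.

Lemma open_nbhsE (T : topologicalType) (U : set T) :
  (forall x, U x -> nbhs x U) -> open U.
Proof. by rewrite openE. Qed.

Section Tau.
Variable X : Z2space.

Definition tau (x : X) : X := Z2act x 1.

Lemma tauK : involutive tau.
Proof.
move=> x; rewrite /tau -Z2actD (_ : 1 + 1 = 0 :> 'Z_2) ?Z2act0//.
exact: val_inj.
Qed.

Lemma tau_continuous : continuous tau.
Proof. exact: Z2act_continuous. Qed.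

Lemma orbit_projP (x y : X) :
  orbit_proj x = orbit_proj y <-> y = x \/ y = tau x.
Proof.
split=> [/eqmodP /existsP[g /eqP->]|[->|->]] //.
  by have [->|->] := Z2_cases g; [left; rewrite Z2act0|right].
by apply/eqmodP/existsP; exists 1.
Qed.

Lemma orbit_proj_tau x : orbit_proj (tau x) = orbit_proj x.
Proof. by apply/esym/orbit_projP; right. Qed.

Lemma orbit_proj_surj (b : orbit_space X) : exists x, orbit_proj x = b.
Proof. by exists (repr b); rewrite /orbit_proj reprK. Qed.

Lemma orbit_proj_continuous : continuous (@orbit_proj X).
Proof. exact: pi_continuous. Qed.

Lemma orbit_proj_open (U : set X) : open U -> open (@orbit_proj X @` U).
Proof.
move=> oU; rewrite /open /= /quotient_open.
have -> : \pi_(quotient_topology {eq_quot orbit_equiv X})%qT @^-1`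
    (@orbit_proj X @` U) = U `|` tau @^-1` U.
  apply/seteqP; split=> [x [y Uy /orbit_projP[->|->]]|x [Ux|Ux]] /=.
  - by left.
  - by right; rewrite tauK.
  - by exists x.
  - by exists (tau x) => //; exact: orbit_proj_tau.
apply: openU => //; apply: open_comp => // x _; exact: tau_continuous.
Qed.

Definition fixfree := forall x : X, tau x <> x.

(** [U] and its translate are the two sheets of the double cover over the image of [U], so sheets
    stand in for evenly covered sets. *)
Definition sheet (U : set X) := open U /\ forall x, U x -> ~ U (tau x).

Lemma sheet_inj U x y : sheet U -> U x -> U y ->
  orbit_proj x = orbit_proj y -> x = y.
Proof. by move=> [_ Ut] Ux Uy /orbit_projP[//|yE]; case: (Ut x Ux);
  rewrite -yE. Qed.

Lemma sheet_tau U : sheet U -> sheet (tau @^-1` U).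
Proof.
move=> [oU Ut]; split; first by apply: open_comp => // x _; exact: tau_continuous.
by move=> x /Ut.
Qed.

(** Disjoint neighbourhoods [A] of [x] and [B] of [tau x] give the sheet of the points of [A] that
    [tau] sends into [B]. Freeness of an involution on a Hausdorff space is checked pointwise in
    this way. *)
Lemma fixfree_sheet (x : X) : hausdorff_space X -> fixfree ->
  exists2 U, sheet U & U x.
Proof.
rewrite open_hausdorff => hX fX.
have [[A B] [/= /set_mem Ax /set_mem Bx] [oA oB AB]] :
    exists2 AB : set X * set X, x \in AB.1 /\ tau x \in AB.2 &
    [/\ open AB.1, open AB.2 & AB.1 `&` AB.2 == set0].
  by apply: hX; apply/eqP => xE; case: (fX x).
exists (A `&` tau @^-1` B); last by split.
split.
  by apply: openI => //; apply: open_comp => // y _; exact: tau_continuous.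
move=> y [Ay By] [Aty _]; move: AB => /eqP; rewrite -subset0 => /(_ (tau y)).
by apply.
Qed.

Lemma free_sheet (x : X) : free_action X -> exists2 U, sheet U & U x.
Proof.
move=> /(_ x)[U Ux Ug]; exists U°; last exact: Ux.
split=> [|y /interior_subset Uy /interior_subset Uty]; first exact: open_interior.
have : (@Z2act X ^~ 1 @` U `&` U) (tau y) by split=> //; exists y.
by rewrite Ug.
Qed.

Lemma sheet_free : (forall x : X, exists2 U, sheet U & U x) -> free_action X.
Proof.
move=> h x; have [U [oU Ut] Ux] := h x; exists U; first exact: open_nbhs_nbhs.
move=> g g0; rewrite -subset0 => _ [[y Uy <-]].
have [gE|->] := Z2_cases g; first by rewrite gE eqxx in g0.
exact: Ut.
Qed.

(** Separating [x] both from [y] and from [tau y] and intersecting the neighbourhoods yields open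
    sets with disjoint images in the orbit space. *)
Lemma orbit_hausdorff : hausdorff_space X -> hausdorff_space (orbit_space X).
Proof.
rewrite !open_hausdorff => hX b b'.
have [x <-] := orbit_proj_surj b; have [y <-] := orbit_proj_surj b'.
move=> xy.
have [[A B] [/= /set_mem Ax /set_mem Bx] [oA oB AB]] :
    exists2 AB : set X * set X, x \in AB.1 /\ y \in AB.2 &
    [/\ open AB.1, open AB.2 & AB.1 `&` AB.2 == set0].
  by apply: hX; apply: contra_neq xy => ->.
have [[A' B'] [/= /set_mem A'x /set_mem B'x] [oA' oB' A'B']] :
    exists2 AB : set X * set X, x \in AB.1 /\ tau y \in AB.2 &
    [/\ open AB.1, open AB.2 & AB.1 `&` AB.2 == set0].
  by apply: hX; apply: contra_neq xy => ->; rewrite orbit_proj_tau.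
exists (@orbit_proj X @` (A `&` A'), @orbit_proj X @` (B `&` tau @^-1` B')) => /=.
  by split; apply/mem_set; [exists x|exists y].
split; try apply: orbit_proj_open; try apply: openI => //.
  by apply: open_comp => // z _; exact: tau_continuous.
apply/eqP; rewrite -subset0 => _ [[u [Au A'u] <-] [v [Bv B'v]]].
move=> /orbit_projP[uE|uE].
  by move: AB => /eqP; rewrite -subset0 => /(_ u); apply; split=> //; rewrite uE.
move: A'B' => /eqP; rewrite -subset0 => /(_ u); apply; split=> //.
by rewrite uE.
Qed.

End Tau.
Arguments tau {X}.

Section Involution.
Variables (T : topologicalType) (f : T -> T).
Hypotheses (fK : involutive f) (cf : continuous f).

Definition inv_act (x : T) (g : 'Z_2) : T := if g == 0 then x else f x.

Lemma inv_act0 x : inv_act x 0 = x. Proof. by []. Qed.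

Lemma inv_actD x g h : inv_act x (g + h) = inv_act (inv_act x g) h.
Proof.
rewrite /inv_act; have [->|->] := Z2_cases g;
  have [->|->] := Z2_cases h => //=; exact/esym/fK.
Qed.

Lemma inv_act_continuous g : continuous (inv_act^~ g).
Proof.
rewrite /inv_act; have [->|->] := Z2_cases g => //= x; exact: cvg_id.
Qed.

Definition involution_space : Z2space :=
  MkZ2space inv_act0 inv_actD inv_act_continuous.

Lemma involution_tau (x : T) : tau (x : involution_space) = f x.
Proof. by []. Qed.

End Involution.

Section OrbitMap.
Variables (Z : Z2space) (B : topologicalType) (f : Z -> B).

Definition orbit_desc (b : orbit_space Z) : B := f (repr b).

Hypothesis ft : forall z, f (tau z) = f z.

Lemma orbit_descE z : orbit_desc (orbit_proj z) = f z.
Proof.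
rewrite /orbit_desc; have : orbit_proj z = orbit_proj (repr (orbit_proj z) : Z).
  by rewrite /orbit_proj reprK.
by move=> /orbit_projP[->|->].
Qed.

Lemma orbit_desc_continuous : continuous f -> continuous orbit_desc.
Proof.
move=> cf; apply/quotient_continuous.
rewrite (_ : _ \o _ = f)//; apply/funext => z; exact: orbit_descE.
Qed.

End OrbitMap.

Lemma line_connected (R : realType) (P : set R) (a b : R) :
  open P -> open (~` P) -> P a -> P b.
Proof.
move=> oP onP Pa; have cR : connected [set: R] by exact/connected_intervalP.
suff -> : P = setT by [].
apply: cR; first by exists a.
  by exists P => //; rewrite setTI.
by exists P; rewrite ?setTI// -openC.
Qed.

Lemma free_fixfree (X : Z2space) : free_action X -> fixfree X.
Proof. by move=> fX x; have [U [_ Ut] Ux] := free_sheet x fX; move=> xE;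
  apply: (Ut x Ux); rewrite xE. Qed.

(** * Lifting to double covers *)

Section LineLifts.
Variables (R : realType) (X : Z2space).
Hypothesis fX : free_action X.

Lemma open_coincidence (T : topologicalType) (a b : T -> X) :
  continuous a -> continuous b ->
  (forall t, orbit_proj (a t) = orbit_proj (b t)) -> open [set t | b t = a t].
Proof.
move=> ca cb ab; apply: open_nbhsE => t /= btat.
have [U sU Uat] := free_sheet (a t) fX.
have nU : nbhs (a t) U by apply: open_nbhs_nbhs; split=> //; case: sU.
have nU' : nbhs (b t) U by rewrite btat.
have /= nA : nbhs t (a @^-1` U `&` b @^-1` U).
  by apply: filterI; [exact: ca|exact: cb].
apply: filterS nA => s [/= Uas Ubs]; apply/esym; exact: (sheet_inj sU).
Qed.

(** The sets where [b] agrees with [a] and with [tau \o a] are open and, as [tau] has no fixed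
    point, complementary; the line being connected, one of them is everything. Uniqueness of lifts
    over other domains is reduced to this case. *)
Lemma line_lift_unique (a b : R -> X) : continuous a -> continuous b ->
  (forall t, orbit_proj (a t) = orbit_proj (b t)) ->
  (forall t, b t = a t) \/ (forall t, b t = tau (a t)).
Proof.
move=> ca cb ab; have o1 := open_coincidence ca cb ab.
have cta : continuous (tau \o a).
  by move=> t; apply: continuous_comp; [exact: ca|exact: tau_continuous].
have o2 : open [set t | b t = tau (a t)].
  by apply: (open_coincidence cta cb) => t; rewrite /= orbit_proj_tau.
have E : [set t | b t = tau (a t)] = ~` [set t | b t = a t].
  apply/seteqP; split=> t /=; first by move=> ->; exact: free_fixfree.
  by have /orbit_projP[|] := ab t.
have E' : [set t | b t = a t] = ~` [set t | b t = tau (a t)].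
  by rewrite E setCK.
have /orbit_projP[h|h] := ab 0; [left|right] => t.
  by apply: (@line_connected R [set t | b t = a t] 0 t o1 _ h); rewrite -E.
by apply: (@line_connected R [set t | b t = tau (a t)] 0 t o2 _ h); rewrite -E'.
Qed.

End LineLifts.

(** The projection is open and injective on a sheet, so a lift that stays in one sheet near [t] is
    there [phi] followed by the local inverse of the projection. *)
Lemma sheet_lift_cvg (X : Z2space) (T : topologicalType) (U : set X)
    (phi : T -> orbit_space X) (F : T -> X) (t : T) :
  sheet U -> continuous phi -> (forall s, orbit_proj (F s) = phi s) ->
  (\forall s \near t, U (F s)) -> F s @[s --> t] --> F t.
Proof.
move=> sU cphi Fphi nU N /=; rewrite nbhsE => -[N' [oN' N't] N'N].
have Ut : U (F t) by exact: nbhs_singleton nU.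
have nV : nbhs (phi t) (@orbit_proj X @` (U `&` N')).
  apply: open_nbhs_nbhs; split; last by exists (F t).
  by apply: orbit_proj_open; apply: openI => //; case: sU.
have nV' : \forall s \near t, (@orbit_proj X @` (U `&` N')) (phi s).
  exact: cphi.
suff : \forall s \near t, N (F s) by [].
apply: filterS2 nV' nU => s [v [Uv N'v] vE] Us; apply: N'N.
by rewrite -(sheet_inj sU Uv Us)// vE Fphi.
Qed.

Section ConvexLifts.
Variables (R : realType) (V : normedModType R) (K : set V).
Hypothesis convK : forall (a b : V) (t : R), K a -> K b -> 0 <= t <= 1 ->
  K (a + t *: (b - a)).
Hypothesis compactK : compact K.
Variable X : Z2space.
Hypothesis fX : free_action X.

Local Notation T := (set_type K).

(** Truncation to the unit interval: it extends segments to the whole line, where [line_lift_unique]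
    applies. *)
Definition clamp (t : R) : R := Num.max 0 (Num.min 1 t).

Lemma clamp_itv t : 0 <= clamp t <= 1.
Proof.
rewrite /clamp le_max lexx /= ge_max ler01 /= ge_min lexx //.
Qed.

Lemma clamp_id t : 0 <= t <= 1 -> clamp t = t.
Proof. by move=> /andP[t0 t1]; rewrite /clamp min_r// max_r. Qed.

Lemma clamp_continuous : continuous clamp.
Proof.
move=> t; apply: continuous_max; first exact: cvg_cst.
by apply: continuous_min; [exact: cvg_cst|exact: cvg_id].
Qed.

Lemma segment_subproof (a b : T) t :
  set_val a + clamp t *: (set_val b - set_val a) \in K.
Proof.
apply/mem_set/convK; [exact: set_valP|exact: set_valP|exact: clamp_itv].
Qed.

Definition segment (a b : T) t : T :=
  exist (fun x => x \in K) _ (segment_subproof a b t).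

Lemma set_val_continuous : continuous (set_val : T -> V).
Proof. exact: initial_continuous. Qed.

Lemma segment0 a b : segment a b 0 = a.
Proof. by apply: val_inj; rewrite /= clamp_id ?lexx ?ler01// scale0r addr0. Qed.

Lemma segment1 a b : segment a b 1 = b.
Proof.
by apply: val_inj; rewrite /= clamp_id ?lexx ?ler01// scale1r addrC subrK.
Qed.

Lemma segment_continuous a b : continuous (segment a b).
Proof.
apply: continuous_comp_initial => t; rewrite set_valE.
apply: (@cvgD _ V); first exact: cvg_cst.
apply: (@cvgZr_tmp _ V); exact: clamp_continuous.
Qed.

Lemma segment_continuousr a t : continuous (segment a ^~ t).
Proof.
apply: continuous_comp_initial => b; rewrite set_valE.
have FF := nbhs_filter b.
apply: (@cvgD _ V T (nbhs b) FF); first exact: cvg_cst.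
apply: (@cvgZl_tmp _ V T (nbhs b) FF); apply: (@cvgB _ V T (nbhs b) FF);
  last exact: cvg_cst.
exact: set_val_continuous.
Qed.

Lemma dist_segment a b t s : `|val (segment a b t) - val (segment a b s)| <=
  `|t - s| * `|val b - val a|.
Proof.
rewrite /= opprD addrACA subrr add0r -scalerBl normrZ ler_wpM2r//.
have C u : [\/ clamp u = 0 /\ u <= 0, clamp u = u /\ 0 <= u <= 1 |
    clamp u = 1 /\ 1 <= u].
  have [u0|u0] := lerP u 0.
    constructor 1; split=> //; rewrite /clamp min_r; last by lra.
    exact: max_l.
  have [u1|u1] := lerP u 1; [constructor 2|constructor 3].
    by rewrite clamp_id ?(ltW u0).
  by rewrite /clamp (min_l (ltW u1)) max_r ?ltW.
case: (ger0P (t - s)) => ts; rewrite ler_norml;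
  by case: (C t) => -[-> ?]; case: (C s) => -[-> ?]; lra.
Qed.

Variables (f : T -> orbit_space X).
Hypothesis cf : continuous f.

Definition subordinate d (a : T) (U : set X) := sheet U /\
  forall b : T, `|val b - val a| < d -> (@orbit_proj X @` U) (f b).

(** A Lebesgue number for the cover of [K] by the sets that [f] maps into the image of a sheet.
    Compactness enters in near-covering form, the parameter being a radius that tends to 0 from the
    right. *)
Lemma lebesgue_number : exists2 d : R, 0 < d & forall a, exists U, subordinate
  d a U.
Proof.
have /compact_near_coveringP/near_covering_withinP cK := compactK.
have := cK R (0^'+) (fun d x => exists2 U, sheet U &
  forall b : T, `|val b - x| < d -> (@orbit_proj X @` U) (f b)).
move=> /(_ _)[x Kx|e /= e0 He].
- pose a : T := exist (fun x => x \in K) x (mem_set Kx).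
  have [z zE] := orbit_proj_surj (f a).
  have [U sU Uz] := free_sheet z fX.
  have : nbhs a (f @^-1` (@orbit_proj X @` U)).
    apply: cf; apply: open_nbhs_nbhs; split; last by exists z.
    by apply: orbit_proj_open; case: sU.
  move=> [_ [[W oW <-] /= Wx] WU].
  have : nbhs x W by exact: open_nbhs_nbhs.
  move=> /nbhs_normP[e /= e0 eW].
  have e20 : 0 < e / 2 by rewrite divr_gt0.
  near=> x' d => /= Kx'; exists U => // b bd; apply: WU => /=.
  apply: eW => /=.
  have -> : x - val b = (x - x') - (val b - x') by rewrite opprB addrA subrK.
  rewrite (le_lt_trans (ler_normB _ _))// (splitr e) ltrD//.
  by rewrite (lt_trans bd)//; near: d; apply: nbhs_right_lt.
- exists (e / 2); first by rewrite divr_gt0.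
  have e2 : 0 < e / 2 by rewrite divr_gt0.
  have ee : `|0 - e / 2| < e.
    by rewrite sub0r normrN gtr0_norm// ltr_pdivrMr// mulr_natr mulr2n ltrDl.
  move=> a; have [U sU HU] := He (e / 2) ee e2 (val a) (set_valP a).
  by exists U.
Unshelve. all: by end_near. Qed.

Section Step.
Variables (d : R) (g0 g1 : T -> T) (F0 : T -> X).
Hypothesis d0 : 0 < d.
Hypothesis dP : forall a, exists U, subordinate d a U.
Hypotheses (cg0 : continuous g0) (cg1 : continuous g1) (cF0 : continuous F0).
Hypothesis F0P : forall x, orbit_proj (F0 x) = f (g0 x).
Hypothesis g01 : forall x, `|val (g1 x) - val (g0 x)| < d / 2.

(** The sheet given by [dP] contains a point of the orbit of [F0 x], so it or its translate contains
    [F0 x] itself. *)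
Lemma sheet_at x : exists2 U, subordinate d (g0 x) U & U (F0 x).
Proof.
have [U [sU HU]] := dP (g0 x).
have [z Uz zE] := HU (g0 x) ltac:(by rewrite subrr normr0).
have : orbit_proj z = orbit_proj (F0 x) by rewrite zE F0P.
move=> /orbit_projP[->|zF]; first by exists U.
exists (tau @^-1` U); last by rewrite /= zF tauK.
split; first exact: sheet_tau.
move=> b /HU[u Uu <-]; exists (tau u); last exact: orbit_proj_tau.
by rewrite /= tauK.
Qed.

Definition goodsheet x U := [/\ sheet U, U (F0 x) &
  forall t, (@orbit_proj X @` U) (f (segment (g0 x) (g1 x) t))].

Lemma goodsheet_lift x U : goodsheet x U ->
  exists c : R -> X, [/\ continuous c, c 0 = F0 x, forall t, U (c t) &
    forall t, orbit_proj (c t) = f (segment (g0 x) (g1 x) t)].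
Proof.
move=> [sU U0 HU].
have /choice[c cP] : forall t, exists u, U u /\ orbit_proj u =
  f (segment (g0 x) (g1 x) t).
  by move=> t; have [u ? ?] := HU t; exists u.
exists c; split; [|by apply: (sheet_inj sU) => //;
  [case: (cP 0)|case: (cP 0) => _ ->; rewrite segment0 F0P]|by move=> t;
    case: (cP t)..].
move=> t; apply: (@sheet_lift_cvg _ _ U (fun t =>
  f (segment (g0 x) (g1 x) t))) => //.
- by move=> s; apply: continuous_comp; [exact: segment_continuous|exact: cf].
- by move=> s; case: (cP s).
- by apply: (@filterE R (nbhs t) (nbhs_filter t)) => s; case: (cP s).
Qed.

(** Two good sheets may differ, but the segment from [g0 x] to [g1 x] lifts inside each of them,
    starting from [F0 x] both times; the two lifts agree, hence so do their ends. *)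
Lemma goodsheet_unique x U U' y y' : goodsheet x U -> goodsheet x U' ->
  U y -> U' y' -> orbit_proj y = f (g1 x) -> orbit_proj y' = f (g1 x) -> y = y'.
Proof.
move=> gU gU' Uy U'y' yE y'E.
have [c [cc c0 Uc cE]] := goodsheet_lift gU.
have [c' [cc' c'0 Uc' c'E]] := goodsheet_lift gU'.
have c1 : c 1 = y.
  by case: gU => sU _ _; apply: (sheet_inj sU) => //; rewrite cE segment1 yE.
have c'1 : c' 1 = y'.
  by case: gU' => sU _ _; apply: (sheet_inj sU) => //; rewrite c'E segment1 y'E.
have [t|h|h] := line_lift_unique fX cc cc'; first by rewrite cE c'E.
  by rewrite -c1 -c'1 h.
by have := h 0; rewrite c0 c'0 => /esym/(free_fixfree fX).
Qed.

Lemma near_goodsheet x U : subordinate d (g0 x) U -> U (F0 x) ->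
  \forall x' \near x, goodsheet x' U.
Proof.
move=> [sU HU] Ux; near=> x'; split=> //.
  near: x'; apply: cF0; apply: open_nbhs_nbhs; split=> //; by case: sU.
move=> t; apply: HU.
(* One half of [d] pays for the motion along the segment, by [g01], and the other half for the
   passage from [x] to [x']. *)
have -> : val (segment (g0 x') (g1 x') t) - val (g0 x) =
   (val (segment (g0 x') (g1 x') t) - val (segment (g0 x') (g1 x') 0)) +
   (val (g0 x') - val (g0 x)).
  by rewrite segment0 addrA subrK.
rewrite (le_lt_trans (ler_normD _ _))// (splitr d) ltr_leD//; last first.
  near: x'.
  have : {for x, continuous ((set_val : T -> V) \o g0)}.
    by apply: continuous_comp; [exact: cg0|exact: set_val_continuous].
  rewrite set_valE.
  by move=> /pseudometric_normed_Zmodule.cvgr_distC_le; apply; rewrite divr_gt0.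
(* A segment depends on its parameter only through [clamp], and at [clamp t] the factor in
   [dist_segment] is at most 1. *)
have : `|val (segment (g0 x') (g1 x') (clamp t)) -
    val (segment (g0 x') (g1 x') 0)| <= 1 * `|val (g1 x') - val (g0 x')|.
  apply: le_trans (dist_segment _ _ _ _) _.
  have /andP[? ?] := clamp_itv t.
  by rewrite ler_wpM2r// subr0 ger0_norm.
rewrite mul1r /= [clamp (clamp t)]clamp_id ?clamp_itv//.
move=> /le_lt_trans; apply; exact: g01.
Unshelve. all: by end_near. Qed.

(** [F1 x] is the end of the lift, starting at [F0 x], of the segment from [g0 x] to [g1 x]. One
    sheet is good for all points near [x], and by [goodsheet_unique] it contains the chosen values
    there, whence continuity. *)
Lemma lift_step : exists2 F1 : T -> X, continuous F1 &
  forall x, orbit_proj (F1 x) = f (g1 x).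
Proof.
have /choice[F1 F1P] : forall x, exists y, exists2 U, goodsheet x U &
    U y /\ orbit_proj y = f (g1 x).
  move=> x; have [U sU Ux] := sheet_at x.
  have gU := nbhs_singleton (near_goodsheet sU Ux).
  by case: (gU) => _ _ /(_ 1)[y Uy yE]; exists y, U; rewrite // yE segment1.
have F1E x : orbit_proj (F1 x) = f (g1 x) by case: (F1P x) => ? _ [].
exists F1 => // x; have [U sU Ux] := sheet_at x.
apply: (@sheet_lift_cvg _ _ U (f \o g1)) => //; first by case: sU.
  by move=> y; apply: continuous_comp; [exact: cg1|exact: cf].
have := near_goodsheet sU Ux; apply: filterS => x' gU.
have [U' gU' [U'F F1x']] := F1P x'.
have [_ _ /(_ 1)[y Uy]] := gU; rewrite segment1 => yE.
by rewrite -(goodsheet_unique gU gU' Uy U'F yE F1x').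
Qed.

End Step.

(** The contraction of [K] to a point [c] is cut into steps shorter than half a Lebesgue number; a
    constant lift at [c] is carried through them by [lift_step]. *)
Lemma lift_convex : exists2 F : T -> X, continuous F &
  forall x, orbit_proj (F x) = f x.
Proof.
have [c|T0] := pselect (exists c : T, True); last first.
  have /choice[F FE] : forall x, exists y, orbit_proj y = f x.
    by move=> x; exact: orbit_proj_surj.
  by exists F => // x; case: T0; exists x.
case: c => c _; have [d d0 dP] := lebesgue_number.
have [B B0 BP] : exists2 B : R, 0 < B & forall x : T, `|val x - val c| <= B.
  have [M [_ HM]] := compact_bounded compactK.
  have M1 : M < `|M| + 1 by rewrite (le_lt_trans (ler_norm M))// ltrDl.
  have HK (x : T) : `|val x| <= `|M| + 1 by apply: (HM _ M1); exact: set_valP.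
  exists ((`|M| + 1) + (`|M| + 1)).
    by rewrite addr_gt0// ltr_wpDl.
  by move=> x; rewrite (le_trans (ler_normB _ _))// lerD.
(* [B] bounds the length of every segment from [c], so each of its [N] equal pieces is shorter than
   [d / 2]. *)
pose N := (Num.truncn (2 * B / d)).+1.
have NB : N%:R^-1 * B < d / 2.
  have : 2 * B / d < N%:R by rewrite truncnS_gt.
  by rewrite ltr_pdivrMr// => h; rewrite mulrC ltr_pdivrMr ?ltr0n//; lra.
have step i x : `|val (segment c x (i.+1%:R / N%:R)) - val (segment c x (i%:R /
  N%:R))| < d / 2.
  apply: le_lt_trans (dist_segment _ _ _ _) _.
  rewrite -mulrBl -natrB// subSnn mul1r ger0_norm ?invr_ge0//.
  by apply: le_lt_trans NB; rewrite ler_wpM2l ?invr_ge0.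
have lift_i i : exists2 F : T -> X, continuous F &
    forall x, orbit_proj (F x) = f (segment c x (i%:R / N%:R)).
  elim: i => [|i [F cF FE]].
    have [z zE] := orbit_proj_surj (f c).
    exists (fun=> z); first exact: (@cst_continuous T X z).
    by move=> x; rewrite mul0r segment0.
  apply: (lift_step d0 dP _ _ cF FE (step i)) => //; exact: segment_continuousr.
have [F cF FE] := lift_i N; exists F => // x.
by rewrite FE divff ?segment1// pnatr_eq0.
Qed.

End ConvexLifts.

(** * Cochains with coefficients in F_2 *)

Lemma F2_cases (x : 'F_2) : x = 0 \/ x = 1.
Proof. by case: x => [[|[|//]] ?]; [left|right]; exact: val_inj. Qed.

Lemma F2_addxx (x : 'F_2) : x + x = 0.
Proof. by have [->|->] := F2_cases x; exact: val_inj. Qed.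

Lemma F2_opp (x : 'F_2) : - x = x.
Proof. by apply/eqP; rewrite -subr_eq0 -opprD F2_addxx oppr0. Qed.

Lemma F2_sign (i : nat) : (-1) ^+ i = 1 :> 'F_2.
Proof. by rewrite F2_opp expr1n. Qed.

Lemma singular_eq (R : realType) (X : topologicalType) n (s s' : singular R X n) :
  (forall x, sval s x = sval s' x) -> s = s'.
Proof. by case: s s' => s cs [s' cs'] /= ss'; apply: eq_exist; apply/funext. Qed.

Lemma bump_leS k l m : (l <= m)%N -> (bump k l <= m.+1)%N.
Proof. by move=> lm; rewrite /bump; case: (k <= l)%N => //=; rewrite ltnW. Qed.

Section Push.
Variables (R : realType) (X Y : topologicalType) (f : X -> Y) (cf : continuous f).

Lemma push_subproof n (s : singular R X n) : continuous (f \o sval s).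
Proof. by move=> x; apply: continuous_comp; [exact: proj2_sig s _|exact: cf]. Qed.

Definition push n (s : singular R X n) : singular R Y n :=
  exist _ _ (@push_subproof n s).

Lemma push_singular_comp m n (s : singular R X n) (g : 'I_m.+1 -> 'I_n.+1) :
  push (singular_comp s g) = singular_comp (push s) g.
Proof. exact: singular_eq. Qed.

Definition pull n (c : cochain R Y 'F_2 n) : cochain R X 'F_2 n :=
  fun s => c (push s).

End Push.

Section Cochains.
Variables (R : realType) (X : topologicalType).
Local Notation C n := (cochain R X 'F_2 n).

Lemma cochainDE n (c d : C n) s : (c + d) s = c s + d s.
Proof. by []. Qed.

Lemma cochain_addxx n (c : C n) : c + c = 0.
Proof. by apply/funext => s; exact: F2_addxx. Qed.

Lemma cochain_opp n (c : C n) : - c = c.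
Proof. by apply/funext => s; exact: F2_opp. Qed.

Lemma cochain_addK n (c d : C n) : c + (c + d) = d.
Proof. by rewrite addrA cochain_addxx add0r. Qed.

Lemma coboundaryD n (c d : C n) :
  coboundary (c + d) = coboundary c + coboundary d.
Proof. by rewrite -{1}(cochain_opp d) coboundaryB cochain_opp. Qed.

Lemma coboundaryE n (c : C n) s :
  coboundary c s = \sum_(i < n.+2) c (singular_comp s (lift i)).
Proof. by apply: eq_bigr => i _; rewrite F2_sign mul1r. Qed.

(** Vertices are selected by a function on the naturals, so that faces compose without casts between
    ordinals; only its values up to [m] matter. *)
Definition sub n (s : singular R X n) m (f : nat -> nat) : singular R X m :=
  singular_comp s (fun i : 'I_m.+1 => inord (f i)).

Lemma eq_sub n (s : singular R X n) m f g :
  (forall i, (i <= m)%N -> f i = g i) -> sub s m f = sub s m g.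
Proof.
move=> fg; rewrite /sub; congr singular_comp; apply/funext => i.
by rewrite fg// -ltnS.
Qed.

Lemma sub_sub n (s : singular R X n) m l f g :
  (forall i, (i <= m)%N -> (f i <= n)%N) -> (forall i, (i <= l)%N ->
    (g i <= m)%N) ->
  sub (sub s m f) l g = sub s l (f \o g).
Proof.
move=> fn gm; rewrite /sub singular_compA; congr singular_comp.
by apply/funext => i; rewrite /= inordK// ltnS gm// -ltnS.
Qed.

Lemma singular_comp_lift n (s : singular R X n.+1) (i : 'I_n.+2) :
  singular_comp s (lift i) = sub s n (bump i).
Proof.
rewrite /sub; congr singular_comp; apply/funext => j; apply: val_inj => /=.
by rewrite inordK// ltnS bump_leS// -ltnS.
Qed.

(* Only meaningful when [n = p + q]; leaving [n] free avoids casts between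
   cochain types. *)
Definition cupn p q n (a : C p) (b : C q) : C n :=
  fun s => a (sub s p id) * b (sub s q (addn p)).

Lemma cupnDl p q n (a a' : C p) (b : C q) :
  cupn (a + a') b = cupn a b + cupn a' b :> C n.
Proof. by apply/funext => s; exact: mulrDl. Qed.

Lemma cupnDr p q n (a : C p) (b b' : C q) :
  cupn a (b + b') = cupn a b + cupn a b' :> C n.
Proof. by apply/funext => s; exact: mulrDr. Qed.

Lemma cupn0 p q n (a : C p) : cupn a (0 : C q) = 0 :> C n.
Proof. by apply/funext => s; exact: mulr0. Qed.

Lemma cup0n p q n (b : C q) : cupn (0 : C p) b = 0 :> C n.
Proof. by apply/funext => s; exact: mul0r. Qed.

Lemma cup1n n (b : C n) : cupn (cst 1 : C 0) b = b.
Proof.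
apply/funext => s; rewrite /cupn mul1r; congr b; apply: singular_eq => x /=.
congr (sval s); apply: val_inj => /=; rewrite /simplex_map_val.
under eq_bigr do rewrite add0n inord_val.
by apply/rowP => j; rewrite summxE (bigD1 j)//= !mxE !eqxx mulr1 big1 ?addr0// => i;
  rewrite eq_sym => /negbTE ij; rewrite !mxE ij mulr0.
Qed.

Lemma cupnA p q r n (a : C p) (b : C q) (c : C r) : n = (p + (q + r))%N ->
  cupn (cupn a b : C (p + q)) c = cupn a (cupn b c : C (q + r)) :> C n.
Proof.
move=> nE; apply/funext => s; rewrite /cupn -mulrA.
congr (a _ * (b _ * c _)); rewrite !sub_sub ?nE//;
  do ?[by apply: eq_sub => i _ /=; rewrite addnA]; move=> i ip /=;
  by rewrite ?leq_add2l ?addnA// (leq_trans ip)// ?leq_add2l leq_addr.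
Qed.

Lemma leibniz p q n (a : C p) (b : C q) : n = (p + q)%N ->
  coboundary (cupn a b : C n) = cupn (coboundary a) b + cupn a (coboundary b).
Proof.
move=> ->; apply/funext => s; rewrite cochainDE /cupn coboundaryE.
pose T (i : nat) : 'F_2 :=
  a (sub s p (bump i)) * b (sub s q (fun j => bump i (p + j)%N)).
transitivity (\sum_(i < (p.+1 + q.+1)%N) T i).
  rewrite addSn addnS; apply: eq_bigr => i _.
  rewrite singular_comp_lift !sub_sub//.
  - by move=> j; exact: bump_leS.
  - by move=> j jq; rewrite leq_add2l.
  - by move=> j; exact: bump_leS.
  - by move=> j jp; rewrite (leq_trans jp)// leq_addr.
rewrite !coboundaryE.
have face_front (i : 'I_p.+2) : singular_comp (sub s p.+1 id) (lift i) =
  sub s p (bump i).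
  rewrite singular_comp_lift sub_sub//.
  - by move=> j jp; rewrite (leq_trans jp)// ltnS leq_addr.
  - by move=> j; exact: bump_leS.
have face_back (i : 'I_q.+2) : singular_comp (sub s q.+1 (addn p)) (lift i) =
    sub s q (fun j => p + bump i j)%N.
  rewrite singular_comp_lift sub_sub//.
  - by move=> j jp; rewrite -addnS leq_add2l.
  - by move=> j; exact: bump_leS.
have bump_out i : (p < i)%N -> sub s p (bump i) = sub s p id.
  move=> pi; apply: eq_sub => j jp.
  by rewrite /bump leqNgt (leq_ltn_trans jp pi).
have -> : \sum_(i < p.+2) a (singular_comp (sub s p.+1 id) (lift i)) =
    \sum_(i < p.+1) a (sub s p (bump i)) + a (sub s p id).
  by rewrite big_ord_recr /= face_front bump_out//; congr (_ + _);
    apply: eq_bigr => i _; rewrite face_front.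
have -> : \sum_(i < q.+2) b (singular_comp (sub s q.+1 (addn p)) (lift i)) =
    b (sub s q (addn p.+1)) + \sum_(k < q.+1) b (sub s q (fun j =>
      p + bump k.+1 j)%N).
  rewrite big_ord_recl face_back; congr (b _ + _).
    by apply: eq_sub => j _ /=; rewrite /bump /= add1n addnS addSn.
  by apply: eq_bigr => k _; rewrite face_back.
(* The last face of the front and the first face of the back both contribute [a] on the first
   [p + 1] vertices times [b] on the last [q + 1]; these two terms cancel modulo 2. *)
have cancel u v w : u + v + (v + w) = u + w :> 'F_2.
  by rewrite addrA -(addrA u) F2_addxx addr0.
rewrite big_split_ord /= mulrDl mulrDr cancel.
congr (_ + _).
  rewrite mulr_suml; apply: eq_bigr => i _; rewrite /T; congr (_ * b _).
  apply: eq_sub => j _; rewrite /bump addSn.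
  by rewrite (leq_trans (leq_ord i) (leq_addr _ _)).
rewrite mulr_sumr; apply: eq_bigr => k _; rewrite /T bump_out ?leq_addr//.
congr (_ * b _); apply: eq_sub => j _.
by rewrite addSnnS /bump leq_add2l addnCA.
Qed.

End Cochains.

Section Pull.
Variables (R : realType) (X Y : topologicalType) (f : X -> Y) (cf : continuous f).

Lemma pullD n (c d : cochain R Y 'F_2 n) : pull cf (c + d) = pull cf c + pull cf d.
Proof. by []. Qed.

Lemma pull_coboundary n (c : cochain R Y 'F_2 n) :
  pull cf (coboundary c) = coboundary (pull cf c).
Proof.
apply/funext => s; rewrite /pull !coboundaryE; apply: eq_bigr => i _.
by rewrite push_singular_comp.
Qed.

Lemma pull_cupn p q n (a : cochain R Y 'F_2 p) (b : cochain R Y 'F_2 q) :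
  pull cf (cupn a b : cochain R Y 'F_2 n) = cupn (pull cf a) (pull cf b).
Proof. by apply/funext => s; rewrite /pull /cupn /sub !push_singular_comp. Qed.

Lemma pull_comp (Z : topologicalType) (g : Y -> Z) (cg : continuous g)
    (h : X -> Z) (ch : continuous h) n (c : cochain R Z 'F_2 n) :
  (forall x, h x = g (f x)) -> pull cf (pull cg c) = pull ch c.
Proof.
move=> hE; apply/funext => s; rewrite /pull; congr c.
by apply: singular_eq => x /=; rewrite hE.
Qed.

End Pull.

Section Exact.
Variables (R : realType) (X : topologicalType).
Local Notation C n := (cochain R X 'F_2 n).

Definition exact n : C n -> Prop :=
  match n with
  | 0 => fun c => c = 0
  | n'.+1 => fun c => exists b : C n', coboundary b = c
  end.

Fixpoint cpow (y : C 1) (m : nat) : C m :=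
  match m with
  | 0 => cst 1
  | m'.+1 => cupn y (@cpow y m')
  end.
Arguments cpow : clear implicits.

Lemma exactD n (c d : C n) : exact c -> exact d -> exact (c + d).
Proof.
case: n c d => [|n] c d /=; first by move=> -> ->; rewrite addr0.
by move=> [b <-] [b' <-]; exists (b + b'); rewrite coboundaryD.
Qed.

Lemma exact_coh n (c d : C n) : exact (c + d) -> exact c -> exact d.
Proof. by move=> cd ec; have := exactD ec cd; rewrite cochain_addK. Qed.

Lemma coh_trans n (c d e : C n) : exact (c + d) -> exact (d + e) -> exact (c + e).
Proof.
by move=> cd de; have := exactD cd de; rewrite -addrA cochain_addK.
Qed.

Lemma exact_cupl n (w : C 1) (c : C n) :
  coboundary w = 0 -> exact c -> exact (cupn w c : C n.+1).
Proof.
move=> w0; case: n c => [|n] c /=.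
  by move=> ->; exists 0; rewrite cupn0 coboundary0.
move=> [b <-]; exists (cupn w b).
by rewrite (@leibniz _ _ 1 n)// w0 cup0n add0r.
Qed.

Lemma exact_cupr p n (b : C p) (c : C n) m : m = (p + n)%N ->
  coboundary c = 0 -> exact (cupn (coboundary b) c : C m.+1).
Proof.
move=> mE c0; exists (cupn b c).
by rewrite (leibniz _ _ mE) c0 cupn0 addr0.
Qed.

Lemma coboundary_cst : coboundary (cst 1 : C 0) = 0.
Proof.
by apply/funext => s; rewrite coboundaryE !big_ord_recr big_ord0 /= add0r F2_addxx.
Qed.

Lemma cpow_cocycle y m : coboundary y = 0 -> coboundary (cpow y m) = 0.
Proof.
move=> y0; elim: m => [|m IH]; first exact: coboundary_cst.
by rewrite /= (@leibniz _ _ 1 m)// y0 cup0n IH cupn0 addr0.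
Qed.

Lemma cohomology_class_eq n (c d : cocycle R X 'F_2 n) :
  cohomology_class c = cohomology_class d <->
  exact (cocycle_val c + cocycle_val d).
Proof.
have -> : cohomology_class c =
  cohomology_class d <-> (c - d) \in coboundaries R X 'F_2 n.
  by rewrite Quotient.idealrBE; split => [h|/eqP//]; exact/eqP.
have cdE : cocycle_val (c - d) = cocycle_val c + cocycle_val d.
  by rewrite -[cocycle_val d]cochain_opp.
case: n c d cdE => [|n] c d cdE /=; rewrite -cdE.
  by split=> [/eqP->|/= h]//; apply/eqP/val_inj.
by split=> [/asboolP|h]//; apply/asboolP.
Qed.

Lemma cohomology_class0 n (c : cocycle R X 'F_2 n) :
  cohomology_class c = 0 <-> exact (cocycle_val c).
Proof.
have -> : 0 = cohomology_class (0 : cocycle R X 'F_2 n).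
  by rewrite /cohomology_class; apply/esym; exact: raddf0.
by rewrite cohomology_class_eq addr0.
Qed.

Lemma cocycle_coboundary n (c : cocycle R X 'F_2 n) : coboundary (cocycle_val
  c) = 0.
Proof. by have /asboolP := cocycleP c. Qed.

(** [cup] multiplies chosen representatives, which differ from the given cocycles by coboundaries;
    replacing one factor at a time changes the product by a coboundary. *)
Lemma cup_power_class (y : cocycle R X 'F_2 1) m :
  cup_power (cohomology_class y) m = 0 <-> exact (cpow (cocycle_val y) m).
Proof.
suff [c [-> <-]] : exists c : cocycle R X 'F_2 m,
    cup_power (cohomology_class y) m = cohomology_class c /\ cocycle_val c =
      cpow (cocycle_val y) m.
  exact: cohomology_class0.
elim: m => [|m [c [cE cV]]];
  first by exists (Cocycle (one_cocycle_subproof R X 'F_2)).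
exists (cup_cocycle y c); split; last by rewrite /= -cV.
rewrite /= /cup cE; apply/cohomology_class_eq; rewrite /=.
set y' := representative _; set c' := representative _.
have yy' : exact (cocycle_val y' + cocycle_val y).
  by apply/cohomology_class_eq; rewrite /cohomology_class reprK.
have cc' : exact (cocycle_val c' + cocycle_val c).
  by apply/cohomology_class_eq; rewrite /cohomology_class reprK.
change (exact (cupn (cocycle_val y') (cocycle_val c') +
  cupn (cocycle_val y) (cocycle_val c) : C m.+1)).
apply: (@coh_trans _ _ (cupn (cocycle_val y) (cocycle_val c'))).
  rewrite -cupnDl; case: yy' => b <-; apply: exact_cupr => //.
  exact: cocycle_coboundary.
by rewrite -cupnDr; apply: exact_cupl => //; exact: cocycle_coboundary.
Qed.

End Exact.
Arguments cpow {R X} y m.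

Lemma pull_cpow (R : realType) (X Y : topologicalType) (f : X -> Y)
    (cf : continuous f) (y : cochain R Y 'F_2 1) m :
  pull cf (cpow y m) = cpow (pull cf y) m.
Proof. by elim: m => [//|m IH]; rewrite /= pull_cupn IH. Qed.

(* [X i k] stands for the [k]-th face of the [i]-th simplex of a prism. *)
Lemma prism_faces (V : nmodType) (X t : nat -> nat -> V) (D : nat -> V) m :
  (forall v : V, v + v = 0) ->
  (forall i k, (k < i)%N -> X i k = t k i.-1) -> (forall i, X i i = D i) ->
  (forall i, X i i.+1 = D i.+1) ->
  (forall i k, (i.+1 < k)%N -> X i k = t k.-1 i) ->
  \sum_(0 <= i < m.+1) \sum_(0 <= k < m.+2) X i k =
  D 0%N + D m.+1 + \sum_(0 <= i < m) \sum_(0 <= k < m.+1) t k i.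
Proof.
move=> V2 Xlt XD XD1 Xgt.
have inner i : (i <= m)%N -> \sum_(0 <= k < m.+2) X i k =
    \sum_(0 <= k < i) t k i.-1 + (D i + D i.+1) + \sum_(i.+1 <= k < m.+1) t k i.
  move=> im; rewrite (@big_cat_nat _ _ _ i.+2)//=.
  rewrite (@big_nat_recr _ _ _ i.+1 0)//= (@big_nat_recr _ _ _ i 0)//= XD XD1.
  rewrite -!addrA; congr (_ + (_ + (_ + _))).
    by apply: eq_big_nat => k /andP[_ ki]; rewrite Xlt.
  rewrite big_add1 /=; apply: eq_big_nat => k /andP[ik _]; by rewrite Xgt.
have -> : \sum_(0 <= i < m.+1) \sum_(0 <= k < m.+2) X i k =
    \sum_(0 <= i < m.+1) \sum_(0 <= k < i) t k i.-1 +
    \sum_(0 <= i < m.+1) (D i + D i.+1) +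
    \sum_(0 <= i < m.+1) \sum_(i.+1 <= k < m.+1) t k i.
  rewrite -!big_split /=; apply: eq_big_nat => i im; exact: inner.
(* Consecutive simplices of the prism share a wall, so the sum telescopes modulo 2. *)
have -> : \sum_(0 <= i < m.+1) (D i + D i.+1) = D 0%N + D m.+1.
  elim: (m) => [|m' IH]; first by rewrite big_nat1.
  by rewrite big_nat_recr//= IH addrA -(addrA (D 0%N)) V2 addr0.
have -> : \sum_(0 <= i < m.+1) \sum_(0 <= k < i) t k i.-1 =
    \sum_(0 <= i < m) \sum_(0 <= k < i.+1) t k i.
  by rewrite big_nat_recl//= big_geq// add0r.
have -> : \sum_(0 <= i < m.+1) \sum_(i.+1 <= k < m.+1) t k i =
    \sum_(0 <= i < m) \sum_(i.+1 <= k < m.+1) t k i.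
  by rewrite big_nat_recr//= [X in _ + X]big_geq// addr0.
have E (u v w : V) : u + v + w = v + (u + w) by rewrite addrCA addrA.
rewrite [LHS]E; congr (_ + _); rewrite -big_split /=.
by apply: eq_big_nat => i /andP[_ im]; rewrite -big_cat_nat//= ltnW.
Qed.

Lemma pair_continuous (T U V : topologicalType) (f : T -> U) (g : T -> V) :
  continuous f -> continuous g -> continuous (fun x => (f x, g x)).
Proof. by move=> cf cg x; exact: (cvg_pair (cf x) (cg x)). Qed.

(** * Homotopy invariance *)

Section Homotopy.
Variables (R : realType) (X Y : topologicalType) (H : X * R -> Y).
Hypothesis cH : continuous H.

Section Prism.
Variables (n : nat) (s : singular R X n).

Definition height m (g : nat -> bool) (x : simplex R m) : R :=
  \sum_(j < m.+1) set_val x 0 j * (g j)%:R.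

Lemma height_continuous m g : continuous (@height m g).
Proof.
rewrite /height; apply: (@continuous_big R) => [|j _ x];
  first exact: add_continuous.
have vc := @initial_continuous _ _ (set_val : @simplex_set R m -> _) x.
apply: (@cvgMr_tmp R _ (nbhs x) (nbhs_filter x)).
exact: (cvg_comp _ _ vc (@coord_continuous _ _ _ 0 j _)).
Qed.

Lemma prism_subproof m (f : nat -> nat) (g : nat -> bool) :
  continuous (fun x : simplex R m =>
    H (sval s (simplex_map (fun i : 'I_m.+1 => inord (f i)) x), height g x)).
Proof.
have cp : continuous (fun x : simplex R m =>
    (sval s (simplex_map (fun i : 'I_m.+1 => inord (f i)) x), height g x)).
  apply: pair_continuous; last exact: height_continuous.
  move=> x; apply: continuous_comp; first exact: simplex_map_continuous.
  exact: (proj2_sig s).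
by move=> x; apply: (continuous_comp (cp x)); exact: cH.
Qed.

(** An affine simplex of the prism over [s], followed by [H]: its vertex [i] lies over vertex [f i]
    of [s], at the top when [g i] holds and at the bottom otherwise. *)
Definition prism m f g : singular R Y m := exist _ _ (@prism_subproof m f g).

End Prism.

Lemma height_simplex_map m l (g : nat -> bool) (u : 'I_m.+1 -> 'I_l.+1) x :
  height g (simplex_map u x) = \sum_(j < m.+1) set_val x 0 j * (g (u j))%:R.
Proof.
rewrite /height /= /simplex_map_val.
under eq_bigr do rewrite summxE mulr_suml.
rewrite exchange_big /=; apply: eq_bigr => j _.
rewrite (bigD1 (u j)) //= !mxE !eqxx mulr1 big1 ?addr0// => i iu.
by rewrite !mxE (negbTE iu) mulr0 mul0r.
Qed.

Lemma eq_prism n (s : singular R X n) m f f' g g' :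
  (forall i, (i <= m)%N -> f i = f' i) -> (forall i, (i <= m)%N -> g i = g' i) ->
  prism s m f g = prism s m f' g'.
Proof.
move=> ff' gg'; apply: singular_eq => x /=; congr (H (sval s (simplex_map _ x), _)).
  by apply/funext => i; rewrite ff'// -ltnS.
by apply: eq_bigr => j _; rewrite gg'// -ltnS.
Qed.

Lemma prism_face n (s : singular R X n) m f g (k : 'I_m.+2) :
  singular_comp (prism s m.+1 f g) (lift k) = prism s m (f \o bump k) (g \o bump k).
Proof.
apply: singular_eq => x /=; congr (H (_, _)); last by rewrite height_simplex_map.
by rewrite -[simplex_map _ (simplex_map _ x)]/((simplex_map _ \o simplex_map _) x)
  simplex_map_comp.
Qed.

Lemma face_prism n (s : singular R X n.+1) m f g (k : 'I_n.+2) :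
  (forall i, (i <= m)%N -> (f i <= n)%N) ->
  prism (singular_comp s (lift k)) m f g = prism s m (bump k \o f) g.
Proof.
move=> fn; apply: singular_eq => x /=; congr (H (_, _)).
rewrite -[simplex_map _ (simplex_map _ x)]/((simplex_map _ \o simplex_map _) x)
  simplex_map_comp; congr (sval s (simplex_map _ x)); apply/funext => i.
have im : (i <= m)%N by rewrite -ltnS.
by apply: val_inj => /=; rewrite !inordK ?ltnS ?bump_leS ?fn.
Qed.

Lemma prism_bottom n (s : singular R X n) (g : nat -> bool) b :
  (forall i, (i <= n)%N -> g i = b) ->
  forall x, sval (prism s n id g) x = H (sval s x, b%:R).
Proof.
move=> gb x /=; congr (H (sval s _, _)).
  apply: val_inj => /=; rewrite /simplex_map_val.
  under eq_bigr do rewrite inord_val.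
  by apply/rowP => j; rewrite summxE (bigD1 j)//= !mxE !eqxx mulr1 big1
    ?addr0// => i;
    rewrite eq_sym => /negbTE ij; rewrite !mxE ij mulr0.
have [_ x1] := set_mem (valP x).
transitivity ((\sum_i val x 0 i) * b%:R); last by rewrite x1 mul1r.
rewrite mulr_suml; apply: eq_bigr => j _.
have jn : (j <= n)%N by rewrite -ltnS.
by rewrite gb// set_valE.
Qed.

Variables (h0 h1 : X -> Y).
Hypotheses (ch0 : continuous h0) (ch1 : continuous h1).
Hypotheses (h0E : forall x, h0 x = H (x, 0)) (h1E : forall x, h1 x = H (x, 1)).

Lemma prism_sum n (c : cochain R Y 'F_2 n) (s : singular R X n) :
  coboundary c = 0 ->
  pull ch0 c s + pull ch1 c s =
  \sum_(0 <= i < n) \sum_(0 <= k < n.+1)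
    c (prism s n (bump k \o unbump i) (ltn i)).
Proof.
move=> c0.
(* [unbump i] repeats vertex [i] and [ltn i] puts the later positions on top, which is the usual
   [i]-th simplex of the prism. The wall [D i] has the positions from [i] on at the top, so [D 0]
   comes from [h1] and [D n.+1] from [h0]. *)
pose X' i k := c (prism s n (unbump i \o bump k) (ltn i \o bump k)).
pose D i := c (prism s n id (leq i)).
have := @prism_faces _ X' (fun k i =>
  c (prism s n (bump k \o unbump i) (ltn i))) D n F2_addxx.
have -> : \sum_(0 <= i < n.+1) \sum_(0 <= k < n.+2) X' i k = 0.
  rewrite big1_seq// => i _.
  have := congr1 (@^~ (prism s n.+1 (unbump i) (ltn i))) c0.
  rewrite coboundaryE big_mkord => cE; rewrite -[RHS]cE.
  by apply: eq_bigr => k _; rewrite prism_face.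
have -> : D 0%N = pull ch1 c s.
  rewrite /D /pull; congr c; apply: singular_eq => x.
  by rewrite (@prism_bottom _ _ _ true)//= h1E.
have -> : D n.+1 = pull ch0 c s.
  rewrite /D /pull; congr c; apply: singular_eq => x.
  by rewrite (@prism_bottom _ _ _ false)/= ?h0E// => i ni; rewrite ltnNge ni.
move=> E; rewrite addrC; apply/eqP; rewrite -subr_eq0 F2_opp; apply/eqP/esym.
apply: E.
- move=> i k ki; rewrite /X' /D; congr (c _); apply: eq_prism => j _ /=;
  rewrite /unbump /bump; lia.
- move=> i; rewrite /X' /D; congr (c _); apply: eq_prism => j _ /=;
  rewrite /unbump /bump; lia.
- move=> i; rewrite /X' /D; congr (c _); apply: eq_prism => j _ /=;
  rewrite /unbump /bump; lia.
- move=> i k ki; rewrite /X' /D; congr (c _); apply: eq_prism => j _ /=;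
  rewrite /unbump /bump; lia.
Qed.

(** The primitive is the prism operator, which sums [c] over the simplices of the prism; the
    right-hand side of [prism_sum] is its sum over the faces of [s]. In degree 0 that side is
    empty. *)
Lemma homotopy_exact n (c : cochain R Y 'F_2 n) :
  coboundary c = 0 -> exact (pull ch0 c + pull ch1 c).
Proof.
case: n c => [|n] c c0.
  by apply/funext => s; rewrite cochainDE prism_sum// big_geq.
exists (fun s => \sum_(0 <= i < n.+1) c (prism s n.+1 (unbump i) (ltn i))).
apply/funext => s; rewrite cochainDE prism_sum// coboundaryE [RHS]exchange_big /=.
rewrite [RHS]big_mkord; apply: eq_bigr => k _.
apply: eq_big_nat => i /andP[_ ni]; rewrite face_prism// => j jn.
rewrite /unbump; lia.
Qed.

End Homotopy.

(** * Pasting of maps and geometry of simplices *)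

Lemma paste_continuous (R : realType) (T Y : topologicalType) (h : T ->
  R) (f g : T -> Y) :
  continuous h -> continuous f -> continuous g -> (forall x, h x = 0 ->
    f x = g x) ->
  continuous (fun x => if 0 <= h x then f x else g x).
Proof.
move=> ch cf cg fg x N /= nN.
suff : \forall y \near x, N (if 0 <= h y then f y else g y) by [].
have [hx|hx|hx] := ltgtP (h x) 0.
- have nh : \forall y \near x, h y < 0.
    by apply: (ch x (fun t => t < 0)); apply: open_nbhs_nbhs; split=> //;
      exact: open_lt.
  move: nN; rewrite leNgt hx /= => nN.
  have nN' : \forall y \near x, N (g y) by exact: cg.
  by near=> y; rewrite ifF; [near: y|apply/negbTE; rewrite -ltNge; near: y].
- have nh : \forall y \near x, 0 < h y.
    by apply: (ch x (fun t => 0 < t)); apply: open_nbhs_nbhs; split=> //;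
      exact: open_gt.
  move: nN; rewrite ltW// => nN.
  have nN' : \forall y \near x, N (f y) by exact: cf.
  by near=> y; rewrite ifT; [near: y|apply/ltW; near: y].
- move: nN; rewrite hx lexx => nN.
  have nN' : \forall y \near x, N (f y) by exact: cf.
  have nN'' : \forall y \near x, N (g y).
    by apply: cg; rewrite -(fg _ hx).
  by near=> y; case: ifP => _; near: y.
Unshelve. all: by end_near. Qed.

Section Simplices.
Variable R : realType.

Lemma simplex_convex n (a b : 'rV[R]_n.+1) (t : R) : @simplex_set R n a ->
  @simplex_set R n b -> 0 <= t <= 1 -> @simplex_set R n (a + t *: (b - a)).
Proof.
move=> [a0 a1] [b0 b1] /andP[t0 t1]; split=> [i|].
  rewrite !mxE; have := a0 i; have := b0 i; move: (a 0 i) (b 0 i) => u v; nra.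
under eq_bigr do rewrite !mxE.
rewrite big_split /= -mulr_sumr sumrB a1 b1 subrr mulr0 addr0//.
Qed.

Lemma simplex_compact n : compact (@simplex_set R n).
Proof.
have -> : @simplex_set R n =
  [set v : 'rV[R]_n.+1 | forall i, `[0, 1]%classic (v 0 i)] `&`
    (fun v : 'rV[R]_n.+1 => \sum_i v 0 i) @^-1` [set 1].
  apply/seteqP; split=> [v [v0 v1]|v [v0 v1]]; split=> // i.
    rewrite /= in_itv /= v0 /= -v1 (bigD1 i)//= lerDl sumr_ge0// => j _; exact: v0.
  by have := v0 i; rewrite /= in_itv /= => /andP[].
apply: compact_closedI;
  first by apply: (@rV_compact R n.+1 (fun=> `[0, 1]%classic)) => i;
    exact: segment_compact.
apply: (@preimage_closed 'rV[R]_n.+1 R (fun v => \sum_i v 0 i));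
  last exact: closed_eq.
move=> x _; move: x; apply: (@continuous_big R) => [|j _ y];
  first exact: add_continuous.
exact: coord_continuous.
Qed.

Lemma simplex_map_vertex m n (f : 'I_m.+1 -> 'I_n.+1) i :
  simplex_map f (vertex R i) = vertex R (f i).
Proof.
apply: val_inj => /=; rewrite /simplex_map_val (bigD1 i)//= big1 ?addr0.
  by rewrite mxE !eqxx scale1r.
by move=> j ji; rewrite mxE (negbTE ji) andbF scale0r.
Qed.

Lemma simplex1E (x : simplex R 1) :
  x = segment (@simplex_convex 1) (vertex R ord0) (vertex R ord_max) (val x 0
    ord_max).
Proof.
have [x0 x1] := set_mem (valP x); move: x1;
  rewrite !big_ord_recl big_ord0 addr0 => x1.
apply: val_inj => /=; rewrite clamp_id; last first.
  have := x0 ord0; have := x0 (lift ord0 ord0).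
  have -> : ord_max = lift ord0 ord0 :> 'I_2 by exact: val_inj.
  by move: x1; move: (val x 0 _) (val x 0 _) => u v; lra.
apply/rowP => i; rewrite !mxE.
have [->|->] : i = ord0 \/ i = lift ord0 ord0.
  by case: i => [[|[|//]] ?]; [left|right]; exact: val_inj.
all: have -> : ord_max = lift ord0 ord0 :> 'I_2 by exact: val_inj.
all: rewrite /=; move: x1; move: (val x 0 _) (val x 0 _) => u v /=; lra.
Qed.

End Simplices.

(** * Cocycles and loops *)

Section PathConcat.
Variables (R : realType) (B : topologicalType).

Definition path0 (s : singular R B 1) := sval s (vertex R ord0).
Definition path1 (s : singular R B 1) := sval s (vertex R ord_max).

Definition path_line (s : singular R B 1) (t : R) : B :=
  sval s (segment (@simplex_convex R 1) (vertex R ord0) (vertex R ord_max) t).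

Lemma path_line_continuous s : continuous (path_line s).
Proof.
move=> t; apply: (@continuous_comp _ _ _ (segment _ _ _));
  last exact: (proj2_sig s).
exact: segment_continuous.
Qed.

(** The join is parametrized by [[-1, 1]], with [s] on the negative half and [t] on the positive
    one, to match the range of [concat_height]. *)
Definition concat_line s t (u : R) :=
  if 0 <= u then path_line t u else path_line s (1 + u).

Lemma concat_line_continuous s t : path1 s = path0 t ->
  continuous (concat_line s t).
Proof.
move=> st; apply: (@paste_continuous _ _ _ id).
- by move=> x; exact: cvg_id.
- exact: path_line_continuous.
- move=> x; apply: (@continuous_comp R R B (fun u => 1 + u) (path_line s));
  last exact: path_line_continuous.
  by apply: cvgD; [exact: cvg_cst|exact: cvg_id].
- by move=> x ->; rewrite addr0 /path_line segment0 segment1.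
Qed.

Definition concat_height (x : simplex R 2) : R :=
  val x 0 (inord 2) - val x 0 (inord 0).

Lemma concat_height_continuous : continuous concat_height.
Proof.
move=> x; have vc := @initial_continuous _ _ (set_val : @simplex_set R 2 -> _) x.
have FF := nbhs_filter x.
rewrite /concat_height.
apply: (@cvgB _ R _ (nbhs x) FF);
  exact: (cvg_comp _ _ vc (@coord_continuous _ _ _ 0 _ _)).
Qed.

(* The triangle with edges [s] and [t] is constant along the lines on which
   the difference of the extreme barycentric coordinates is constant. *)
Lemma path_concat (s t : singular R B 1) : path1 s = path0 t ->
  exists u : singular R B 1, [/\ path0 u = path0 s, path1 u = path1 t &
    forall c : cochain R B 'F_2 1, coboundary c = 0 -> c u = c s + c t].
Proof.
move=> st.
have cT : continuous (concat_line s t \o concat_height).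
  move=> x; apply: continuous_comp; first exact: concat_height_continuous.
  exact: concat_line_continuous.
pose T : singular R B 2 := exist _ _ cT.
have hE (f : 'I_2 -> 'I_3) (x : simplex R 1) (k : 'I_3) :
    val (simplex_map f x) 0 k =
    val x 0 ord0 * (k == f ord0)%:R + val x 0 ord_max * (k == f ord_max)%:R.
  rewrite /= /simplex_map_val !big_ord_recl big_ord0 addr0 !mxE /= !set_valE.
  have -> : lift ord0 ord0 = ord_max :> 'I_2 by exact: val_inj.
  reflexivity.
have x01 (x : simplex R 1) : val x 0 ord0 = 1 - val x 0 ord_max.
  have [_] := set_mem (valP x); rewrite !big_ord_recl big_ord0 addr0 => <-.
  have -> : lift ord0 ord0 = ord_max :> 'I_2 by exact: val_inj.
  exact/esym/addrK.
(* Opposite vertex 0 the height is the last coordinate and gives [t]; opposite vertex 2 it is minus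
   the first coordinate and gives [s]. The remaining face is the concatenation. *)
have Tt : singular_comp T (lift ord0) = t.
  apply: singular_eq => x /=; rewrite /concat_height !hE -!val_eqE /= !inordK//=.
  rewrite !mulr0 !mulr1 !add0r subr0 /concat_line.
  have [x0 _] := set_mem (valP x); rewrite (x0 ord_max).
  by rewrite /path_line -simplex1E.
have Ts : singular_comp T (lift ord_max) = s.
  apply: singular_eq => x /=; rewrite /concat_height !hE -!val_eqE /= !inordK//=.
  rewrite !mulr0 !mulr1 !add0r !addr0 x01 opprB /concat_line.
  have [x0 _] := set_mem (valP x); have x00 := x0 ord0; rewrite x01 in x00.
  case: ifPn => h; last by rewrite addrC subrK /path_line -simplex1E.
  have x1 : val x 0 ord_max = 1 by lra.
  rewrite x1 subrr [x in RHS]simplex1E x1 /path_line segment0 segment1.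
  exact/esym.
exists (singular_comp T (lift (inord 1))); split.
- rewrite -Ts /path0 /= !simplex_map_vertex;
  congr (concat_line _ _ (concat_height (vertex _ _))).
  by apply: val_inj; rewrite /= inordK.
- rewrite -Tt /path1 /= !simplex_map_vertex;
  congr (concat_line _ _ (concat_height (vertex _ _))).
  by apply: val_inj; rewrite /= inordK.
- move=> c c0; have := congr1 (@^~ T) c0;
  rewrite coboundaryE !big_ord_recl big_ord0 addr0.
  have -> : lift ord0 (lift ord0 ord0) = ord_max :> 'I_3 by exact: val_inj.
  have -> : lift ord0 ord0 = inord 1 :> 'I_3 by apply: val_inj; rewrite /= inordK.
  rewrite Tt Ts => cE; apply/eqP; rewrite -subr_eq0 F2_opp; apply/eqP.
  by rewrite -[RHS]cE addrA addrC addrA.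
Qed.

Lemma path_rev (s : singular R B 1) :
  exists u : singular R B 1, path0 u = path1 s /\ path1 u = path0 s.
Proof.
exists (singular_comp s (@rev_ord 2)); rewrite /path0 /path1 /= !simplex_map_vertex.
by split; congr (sval s (vertex R _)); exact: val_inj.
Qed.

Definition path_connected (x y : B) := exists s, path0 s = x /\ path1 s = y.

Lemma path_connected_refl x : path_connected x x.
Proof. by exists (exist _ (cst x) (@cst_continuous (simplex R 1) B x)). Qed.

Lemma path_connected_sym x y : path_connected x y -> path_connected y x.
Proof. by move=> [s [<- <-]]; have [u [? ?]] := path_rev s; exists u. Qed.

Lemma path_connected_trans x y z :
  path_connected x y -> path_connected y z -> path_connected x z.
Proof.
move=> [s [<- <-]] [t [st <-]]; have [u [? ? _]] := path_concat (esym st).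
by exists u.
Qed.

(** [choose] returns the same point from every start that satisfies the predicate, so this is one
    base point for each path component. *)
Definition path_root (x : B) : B := choose (fun y => `[< path_connected x y >]) x.

Lemma path_rootP x : path_connected (path_root x) x.
Proof.
apply/path_connected_sym/asboolP;
  apply: (@chooseP _ (fun y => `[< path_connected x y >])).
exact/asboolP/path_connected_refl.
Qed.

Lemma path_root_eq x y : path_connected x y -> path_root x = path_root y.
Proof.
move=> xy; have e : (fun z => `[< path_connected x z >]) =
  (fun z => `[< path_connected y z >]).
  apply/funext => z; apply: asbool_equiv_eq; split => ?.
    by apply: path_connected_trans; first exact: (path_connected_sym xy).
  by apply: path_connected_trans; first exact: xy.
rewrite /path_root e; apply: choose_id; apply/asboolP.
  exact: path_connected_sym.
exact: path_connected_refl.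
Qed.

(** [f] is arbitrary, in general discontinuous: a 0-cochain is just a function on points. *)
Definition fun0 (f : B -> 'F_2) : cochain R B 'F_2 0 :=
  fun s => f (sval s (vertex R ord0)).

Lemma coboundary_fun0 f (s : singular R B 1) :
  coboundary (fun0 f) s = f (path1 s) + f (path0 s).
Proof.
rewrite coboundaryE !big_ord_recl big_ord0 addr0 /fun0 /= !simplex_map_vertex.
by congr (f (sval s (vertex R _)) + f (sval s (vertex R _))); exact: val_inj.
Qed.

Lemma coboundary2_fun0 f : coboundary (coboundary (fun0 f)) = 0.
Proof.
apply/funext => s; rewrite coboundaryE !big_ord_recl big_ord0 addr0
  !coboundary_fun0.
rewrite /path0 /path1 /= !simplex_map_vertex.
pose w k := f (sval s (vertex R (inord k : 'I_3))).
have wE (i : 'I_3) : f (sval s (vertex R i)) = w (val i) by rewrite /w inord_val.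
rewrite !wE /= /bump /=; move: (w _) (w _) (w _) => a b c.
by case: (F2_cases a) => ->; case: (F2_cases b) => ->; case: (F2_cases c) => ->;
  exact: val_inj.
Qed.

(** The primitive at [x] is the value of [c] on a chosen path to [x] from the base point of its
    component. *)
Lemma exact_of_loops (c : cochain R B 'F_2 1) : coboundary c = 0 ->
  (forall s, is_loop s -> c s = 0) -> exact c.
Proof.
move=> c0 cl; have /choice[p pP] := path_rootP.
exists (fun0 (fun x => c (p x))); apply/funext => s; rewrite coboundary_fun0.
have [p0 p1] := pP (path0 s); have [q0 q1] := pP (path1 s).
have rE : path_root (path0 s) = path_root (path1 s) by apply: path_root_eq;
  exists s.
(* The loop [v] follows the chosen path to the start of [s], then [s], then the reverse [r] of the
   chosen path to its end. The loop [w] is that last path followed by [r], so [c] takes equal values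
   on both. *)
have [u [u0 u1 uc]] := path_concat p1.
have [r [r0 r1]] := path_rev (p (path1 s)).
have [v [v0 v1 vc]] := path_concat (etrans u1 (esym (etrans r0 q1))).
have [w [w0 w1 wc]] := path_concat (esym r0).
have lv : is_loop v by rewrite /is_loop -/(path0 v) -/(path1 v) v0 v1 u0 p0 r1 q0.
have lw : is_loop w by rewrite /is_loop -/(path0 w) -/(path1 w) w0 w1 r1.
have := cl _ lv; rewrite vc// uc//; have := cl _ lw; rewrite wc//.
move: (c _) (c _) (c _) (c _) => a b d e.
by case: (F2_cases a) => ->; case: (F2_cases b) => ->; case: (F2_cases d) => ->;
  case: (F2_cases e) => -> /eqP h1 /eqP h2; apply/eqP; move: h1 h2; vm_compute.
Qed.

End PathConcat.
Arguments fun0 {R B} f.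

Lemma pull_fun0 (R : realType) (X Y : topologicalType) (f : Y -> X)
    (cf : continuous f) (e : X -> 'F_2) :
  pull cf (fun0 e) = fun0 (e \o f) :> cochain R Y 'F_2 0.
Proof. by []. Qed.

Lemma coboundary_fun0_shift (R : realType) (X : topologicalType) (f g : X -> 'F_2) :
  (forall x, g x = f x + 1) ->
  coboundary (fun0 g) = coboundary (fun0 f) :> cochain R X 'F_2 1.
Proof.
move=> gE; apply/funext => s; rewrite !coboundary_fun0 !gE addrACA F2_addxx.
exact: addr0.
Qed.

(** * The Stiefel-Whitney class of a free Z_2-space *)

Section FreeSpace.
Variables (R : realType) (X : Z2space).
Hypothesis fX : free_action X.

Local Notation proj := (@orbit_proj_continuous X).
Local Notation tauc := (@tau_continuous X).

Lemma simplex_lift n (t : singular R (orbit_space X) n) :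
  exists s : singular R X n, push proj s = t.
Proof.
have [F cF FE] := lift_convex (@simplex_convex R n) (@simplex_compact R n) fX
  (proj2_sig t).
by exists (exist _ F cF); apply: singular_eq => x /=; exact: FE.
Qed.

(** On the segment from the vertex [c] to [x], the alternative of [line_lift_unique] is decided at
    [c], hence in the same way for all [x]. *)
Lemma simplex_lift_unique n (s s' : singular R X n) :
  push proj s = push proj s' -> s' = s \/ s' = push tauc s.
Proof.
move=> ss'; pose c : simplex R n := vertex R ord0.
have E x : orbit_proj (sval s x) = orbit_proj (sval s' x).
  by have := congr1 (fun u => sval u x) ss'.
have line (u : singular R X n) x : continuous (fun t =>
  sval u (segment (@simplex_convex R n) c x t)).
  move=> t; apply: (@continuous_comp _ _ _ (segment _ _ _));
    first exact: segment_continuous.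
  exact: (proj2_sig u).
have C x := line_lift_unique fX (line s x) (line s' x) (fun t => E _).
have c0 x : segment (@simplex_convex R n) c x 0 = c := segment0 _ _ _.
have c1 x : segment (@simplex_convex R n) c x 1 = x := segment1 _ _ _.
have /orbit_projP[h|h] := E c; [left|right]; apply: singular_eq => x /=.
- have [/(_ 1)|/(_ 0)] := C x; rewrite ?c1 ?c0// => h'.
  by case: (free_fixfree fX (x := sval s c)); rewrite -h' h.
- have [/(_ 0)|/(_ 1)] := C x; rewrite ?c1 ?c0// => h'.
  by case: (free_fixfree fX (x := sval s c)); rewrite -h h'.
Qed.

Lemma pull_proj_inj n : injective (@pull R X (orbit_space X) _ proj n).
Proof.
move=> a b ab; apply/funext => t; have [s <-] := simplex_lift t.
by have := congr1 (@^~ s) ab.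
Qed.

(** The value on a simplex is read off at a lift; the two lifts are exchanged by [tau], which leaves
    [c] unchanged. *)
Lemma descend n (c : cochain R X 'F_2 n) : pull tauc c = c ->
  exists c', pull proj c' = c.
Proof.
move=> ct; have /choice[l lP] := @simplex_lift n.
exists (fun t => c (l t)); apply/funext => s; rewrite /pull.
set u := l _; have [e|e] :=
  simplex_lift_unique (lP (push proj s) : push proj u = _).
  by rewrite e.
by rewrite -{1}ct /pull e.
Qed.

Definition odd_function (eta : X -> 'F_2) := forall x, eta (tau x) = eta x + 1.

(** The indicator of the points that are not the chosen representative of their orbit. *)
Lemma odd_function_exists : exists eta, odd_function eta.
Proof.
exists (fun x => (x != repr (orbit_proj x))%:R) => x.
rewrite orbit_proj_tau; set r := repr _.
have : orbit_proj x = orbit_proj (r : X) by rewrite /orbit_proj /r reprK.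
move=> /orbit_projP[->|->].
  by rewrite eqxx/= (introN eqP) ?add0r//; exact: free_fixfree.
rewrite eqxx/= (introN eqP) ?F2_addxx//.
by move/esym; exact: free_fixfree.
Qed.

(** [eta] labels the two points of each orbit, and [y] records whether the label changes between the
    ends of a lifted path. *)
Definition sw_cocycle (y : cochain R (orbit_space X) 'F_2 1) :=
  exists2 eta, odd_function eta & pull proj y = coboundary (fun0 eta).

Lemma odd_coboundary eta : odd_function eta ->
  pull tauc (coboundary (fun0 eta)) = coboundary (fun0 eta) :> cochain R X 'F_2 1.
Proof.
by move=> oe; rewrite pull_coboundary pull_fun0; exact: coboundary_fun0_shift.
Qed.

Lemma sw_cocycle_exists eta : odd_function eta ->
  exists2 y, sw_cocycle y & pull proj y = coboundary (fun0 eta).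
Proof.
move=> oe; have [y yE] := descend (odd_coboundary oe).
by exists y => //; exists eta.
Qed.

Lemma sw_cocycle_coboundary y : sw_cocycle y -> coboundary y = 0.
Proof.
move=> [eta oe yE]; apply: pull_proj_inj.
by rewrite pull_coboundary yE coboundary2_fun0; apply/funext => s.
Qed.

(** A lift of a loop either closes or ends at the translate of its start, and [eta] is odd. This
    gives the values of [y] on loops, which determine its class by [exact_of_loops]. *)
Lemma sw_cocycle_sw1 (y : cocycle R (orbit_space X) 'F_2 1) :
  sw_cocycle y -> sw1 R X = cohomology_class y.
Proof.
move=> [eta oe yE].
have loopE s : is_loop s ->
  cocycle_val y s = if `[< lifts_to_loop s >] then 0 else 1.
  have [t <-] := simplex_lift s; move=> tl.
  have -> : cocycle_val y (push proj t) = eta (path1 t) + eta (path0 t).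
    by rewrite -coboundary_fun0 -yE.
  have /orbit_projP tl' : orbit_proj (path0 t) = orbit_proj (path1 t) by exact: tl.
  case: asboolP => [[t' t'E t'l]|nl].
    have : push proj t = push proj t' by apply: singular_eq => x; exact/esym/t'E.
    move=> /simplex_lift_unique tt'.
    have t'l' : path0 t' = path1 t' by exact: t'l.
    suff -> : path1 t = path0 t by rewrite F2_addxx.
    case: tt' => t'tE; move: t'l'; rewrite t'tE => //.
    by rewrite /path0 /path1 /= => /(can_inj (@tauK X)).
  case: tl' => [E|->]; first by case: nl; exists t => //; exact/esym.
  by rewrite oe addrAC F2_addxx add0r.
(* Any class that [xget] may return has the same values on loops as [y]; the class of [y] itself
   satisfies [is_sw1], so the default value is never reached. *)
rewrite /sw1; case: xgetP => [u _ uP|].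
  pose c := repr u; have uE : u =
    cohomology_class c by rewrite /cohomology_class reprK.
  rewrite uE; apply/cohomology_class_eq/exact_of_loops.
    by rewrite coboundaryD !cocycle_coboundary addr0.
  move=> s sl; rewrite cochainDE loopE//.
  have := uP s sl; rewrite uE eval_loop_class// => ->.
  by rewrite F2_addxx.
move=> /(_ (cohomology_class y)); case=> s sl; rewrite eval_loop_class//.
exact: loopE.
Qed.

Lemma sw1_power y m : sw_cocycle y ->
  cup_power (sw1 R X) m = 0 <-> exact (cpow y m).
Proof.
move=> swy; have y0 := sw_cocycle_coboundary swy.
have yc : y \in @is_cocycle R (orbit_space X) 'F_2 1 by apply/asboolP.
by rewrite (@sw_cocycle_sw1 (Cocycle yc))// cup_power_class.
Qed.

End FreeSpace.

Lemma cluster_image (T Y : topologicalType) (f : T -> Y) (p q : T) :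
  continuous f -> hausdorff_space Y -> cluster (nbhs p) q -> f p = f q.
Proof.
move=> cf hY pq; apply: hY => A B nA nB.
have [x [Ax Bx]] := pq (f @^-1` A) (f @^-1` B) (cf _ _ nA) (cf _ _ nB).
by exists (f x).
Qed.

(** * The twisted product *)

Section PuncturedPlane.
Variable R : realType.

(** The punctured plane replaces the circle, so that straight paths in it need no normalization. *)
Definition punctured_set : set (R * R) := [set z | 0 < z.1 ^+ 2 + z.2 ^+ 2].

Definition punctured : topologicalType := set_type punctured_set.

Implicit Type z : punctured.

Definition re z : R := (set_val z).1.
Definition im z : R := (set_val z).2.

Lemma punctured_gt0 z : 0 < re z ^+ 2 + im z ^+ 2.
Proof. exact: (set_valP z). Qed.

Lemma punctured_eq z z' : re z = re z' -> im z = im z' -> z = z'.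
Proof.
move=> rE iE; apply: val_inj; have := rE; have := iE; rewrite /re /im !set_valE /=.
by case: (val z) => a b; case: (val z') => a' b' /= -> ->.
Qed.

Lemma re_continuous : continuous re.
Proof.
move=> z; apply: (@continuous_comp _ _ _ (set_val : punctured -> _) fst).
  exact: initial_continuous.
exact: cvg_fst.
Qed.

Lemma im_continuous : continuous im.
Proof.
move=> z; apply: (@continuous_comp _ _ _ (set_val : punctured -> _) snd).
  exact: initial_continuous.
exact: cvg_snd.
Qed.

Definition mkpt (a b : R) (h : 0 < a ^+ 2 + b ^+ 2) : punctured :=
  exist (fun w => w \in punctured_set) (a, b) (mem_set h).

Lemma re_mkpt a b h : re (@mkpt a b h) = a. Proof. by rewrite /re set_valE. Qed.
Lemma im_mkpt a b h : im (@mkpt a b h) = b. Proof. by rewrite /im set_valE. Qed.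

Lemma mkpt_continuous (T : topologicalType) (a b : T -> R)
    (h : forall t, 0 < a t ^+ 2 + b t ^+ 2) :
  continuous a -> continuous b -> continuous (fun t => mkpt (h t)).
Proof.
move=> ca cb; apply: continuous_comp_initial; rewrite set_valE.
exact: pair_continuous.
Qed.

Lemma neg_subproof z : 0 < (- re z) ^+ 2 + (- im z) ^+ 2.
Proof. by rewrite !sqrrN punctured_gt0. Qed.
Definition neg z := mkpt (neg_subproof z).

Lemma conj_subproof z : 0 < (re z) ^+ 2 + (- im z) ^+ 2.
Proof. by rewrite !sqrrN punctured_gt0. Qed.
Definition conjp z := mkpt (conj_subproof z).

Lemma muli_subproof z : 0 < (- im z) ^+ 2 + re z ^+ 2.
Proof. by rewrite !sqrrN addrC punctured_gt0. Qed.
Definition muli z := mkpt (muli_subproof z).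

Lemma opp_continuous (T : topologicalType) (f : T -> R) :
  continuous f -> continuous (fun t => - f t).
Proof. by move=> cf t; apply: cvgN; exact: cf. Qed.

Lemma neg_continuous : continuous neg.
Proof.
by apply: mkpt_continuous; apply: opp_continuous;
  [exact: re_continuous|exact: im_continuous].
Qed.

Lemma conjp_continuous : continuous conjp.
Proof.
by apply: mkpt_continuous; [|apply: opp_continuous];
  [exact: re_continuous|exact: im_continuous].
Qed.

Lemma muli_continuous : continuous muli.
Proof.
by apply: mkpt_continuous; [apply: opp_continuous|];
  [exact: im_continuous|exact: re_continuous].
Qed.

Definition reimE := (re_mkpt, im_mkpt).

Lemma negK : involutive neg.
Proof. by move=> z; apply: punctured_eq; rewrite !reimE opprK. Qed.
Lemma conjpK : involutive conjp.
Proof. by move=> z; apply: punctured_eq; rewrite !reimE ?opprK. Qed.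
Lemma muli_muli z : muli (muli z) = neg z.
Proof. by apply: punctured_eq; rewrite !reimE. Qed.
Lemma muli_neg z : muli (neg z) = neg (muli z).
Proof. by apply: punctured_eq; rewrite !reimE. Qed.
Lemma conjp_neg z : conjp (neg z) = neg (conjp z).
Proof. by apply: punctured_eq; rewrite !reimE. Qed.
Lemma conjp_muli z : conjp (muli z) = neg (muli (conjp z)).
Proof. by apply: punctured_eq; rewrite !reimE ?opprK. Qed.

Lemma neg_neq z : neg z <> z.
Proof.
move=> h; have := punctured_gt0 z.
have := congr1 re h; have := congr1 im h; rewrite !reimE => h1 h2; nra.
Qed.

Lemma muli_neq z : muli z <> z.
Proof.
move=> h; have := punctured_gt0 z.
have := congr1 re h; have := congr1 im h; rewrite !reimE => h1 h2; nra.
Qed.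

Lemma punctured_hausdorff : hausdorff_space punctured.
Proof.
move=> z z' zz'; apply: punctured_eq.
  exact: (cluster_image re_continuous (@Rhausdorff R) zz').
exact: (cluster_image im_continuous (@Rhausdorff R) zz').
Qed.

End PuncturedPlane.

Section Twist.
Variables (R : realType) (X : Z2space).
Hypotheses (hX : hausdorff_space X) (ffX : fixfree X).

Definition induced (Z : Z2space) (g : Z -> Z) : orbit_space Z -> orbit_space Z :=
  orbit_desc (@orbit_proj Z \o g).

Lemma inducedE (Z : Z2space) (g : Z -> Z) z :
  (forall z, orbit_proj (g (tau z)) = orbit_proj (g z)) ->
  induced g (orbit_proj z) = orbit_proj (g z).
Proof. by move=> gt; rewrite /induced orbit_descE. Qed.

Lemma induced_continuous (Z : Z2space) (g : Z -> Z) :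
  (forall z, orbit_proj (g (tau z)) = orbit_proj (g z)) ->
  continuous g -> continuous (induced g).
Proof.
move=> gt cg; apply: orbit_desc_continuous => // z.
by apply: continuous_comp; [exact: cg|exact: orbit_proj_continuous].
Qed.

Local Notation P := (punctured R).
Definition twE : topologicalType := (X * P)%type.

Definition twn (e : twE) : twE := (e.1, neg e.2).
Definition tws (e : twE) : twE := (tau e.1, conjp e.2).
Definition twr (e : twE) : twE := (e.1, muli e.2).

Lemma prod_continuous (f : X -> X) (g : P -> P) : continuous f -> continuous g ->
  continuous (fun e : twE => (f e.1, g e.2) : twE).
Proof.
move=> cf cg; apply: (@pair_continuous twE X P) => e.
  by apply: (@continuous_comp _ _ _ fst f); [exact: cvg_fst|exact: cf].
by apply: (@continuous_comp _ _ _ snd g); [exact: cvg_snd|exact: cg].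
Qed.

Lemma twn_continuous : continuous twn.
Proof.
by apply: (@prod_continuous id); [move=> x; exact: cvg_id|exact: neg_continuous].
Qed.
Lemma tws_continuous : continuous tws.
Proof. by apply: prod_continuous;
  [exact: tau_continuous|exact: conjp_continuous]. Qed.
Lemma twr_continuous : continuous twr.
Proof.
by apply: (@prod_continuous id); [move=> x; exact: cvg_id|exact: muli_continuous].
Qed.

Lemma twnK : involutive twn. Proof. by case=> x z; rewrite /twn /= negK. Qed.

(** The group generated by [twn] and [tws] is divided out in two steps, each by a single involution,
    so that the results on double covers apply to each. *)
Definition tw1 := involution_space twnK twn_continuous.

Local Notation p1 := (@orbit_proj tw1).

Lemma tws_tau (e : tw1) : p1 (tws (tau e)) = p1 (tws e).
Proof.
rewrite -[RHS]orbit_proj_tau; congr p1.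
by case: e => x z; rewrite /tws /= /twn /= conjp_neg.
Qed.

Lemma twr_tau (e : tw1) : p1 (twr (tau e)) = p1 (twr e).
Proof.
rewrite -[RHS]orbit_proj_tau; congr p1.
by case: e => x z; rewrite /twr /= /twn /= muli_neg.
Qed.

Definition s1 : orbit_space tw1 -> orbit_space tw1 := induced (tws : tw1 -> tw1).
Definition r1 : orbit_space tw1 -> orbit_space tw1 := induced (twr : tw1 -> tw1).

Lemma s1E e : s1 (p1 e) = p1 (tws e). Proof. exact: (inducedE _ tws_tau). Qed.
Lemma r1E e : r1 (p1 e) = p1 (twr e). Proof. exact: (inducedE _ twr_tau). Qed.

Lemma s1K : involutive s1.
Proof.
move=> b; have [e <-] := orbit_proj_surj b; rewrite !s1E.
by case: e => x z; rewrite /tws /= tauK conjpK.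
Qed.

Lemma s1_continuous : continuous s1.
Proof. exact: (induced_continuous tws_tau tws_continuous). Qed.

Lemma r1_continuous : continuous r1.
Proof. exact: (induced_continuous twr_tau twr_continuous). Qed.

Definition tw2 := involution_space s1K s1_continuous.
Local Notation p2 := (@orbit_proj tw2).

(** The conjugate of i z is minus i times the conjugate of z, so [twr] and [tws] commute up to
    [twn]. *)
Lemma r1_tau (b : tw2) : p2 (r1 (tau b)) = p2 (r1 b).
Proof.
rewrite -[RHS]orbit_proj_tau; congr p2; rewrite !involution_tau.
have [e <-] := orbit_proj_surj b; rewrite !(s1E, r1E) -[LHS]orbit_proj_tau.
congr p1; case: e => x z.
by rewrite /twr /tws /tau /= /inv_act /= /twn /= conjp_muli.
Qed.

Definition r2 : orbit_space tw2 -> orbit_space tw2 := induced (r1 : tw2 -> tw2).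

Lemma r2E b : r2 (p2 b) = p2 (r1 b). Proof. exact: (inducedE _ r1_tau). Qed.

(** The square of [twr] is [twn], which is trivial after the first quotient. *)
Lemma r2K : involutive r2.
Proof.
move=> b; have [b1 <-] := orbit_proj_surj b; have [e <-] := orbit_proj_surj b1.
rewrite !r2E !r1E; congr p2; rewrite -[RHS]orbit_proj_tau; congr p1.
by case: e => x z; rewrite /twr /= muli_muli.
Qed.

Lemma r2_continuous : continuous r2.
Proof. exact: (induced_continuous r1_tau r1_continuous). Qed.

Definition twist := involution_space r2K r2_continuous.

Definition twpt (e : twE) : twist := p2 (p1 e).

Lemma twpt_tau e : tau (twpt e) = twpt (twr e).
Proof. by rewrite /twpt involution_tau r2E r1E. Qed.

Lemma twpt_surj (y : twist) : exists e, twpt e = y.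
Proof.
have [b1 <-] := orbit_proj_surj (y : orbit_space tw2).
by have [e <-] := orbit_proj_surj b1; exists e.
Qed.

Lemma twpt_continuous : continuous twpt.
Proof.
move=> e; apply: (@continuous_comp twE (orbit_space tw1) _ p1 p2).
  exact: (@orbit_proj_continuous tw1).
exact: (@orbit_proj_continuous tw2).
Qed.

Lemma twpt_eq e e' : twpt e = twpt e' ->
  (e'.1 = e.1 /\ (e'.2 = e.2 \/ e'.2 = neg e.2)) \/
  (e'.1 = tau e.1 /\ (e'.2 = conjp e.2 \/ e'.2 = neg (conjp e.2))).
Proof.
move=> /orbit_projP[/esym|]; last rewrite involution_tau s1E => /esym.
  by move=> /orbit_projP[->|->]; left; split=> //; [left|right].
by move=> /orbit_projP[->|->]; right; split=> //; [left|right].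
Qed.

Lemma twpt_n e : twpt (twn e) = twpt e.
Proof. by rewrite /twpt; congr p2; exact: (orbit_proj_tau (e : tw1)). Qed.

Lemma twpt_s e : twpt (tws e) = twpt e.
Proof. by rewrite /twpt -s1E; exact: (orbit_proj_tau (p1 e : tw2)). Qed.

Lemma fixfree1 : fixfree tw1.
Proof. by move=> [x z]; rewrite /tau /= /inv_act /= => -[] /neg_neq. Qed.

Lemma fixfree2 : fixfree tw2.
Proof.
move=> b; rewrite involution_tau;
  have [e <-] := orbit_proj_surj (b : orbit_space tw1).
by rewrite s1E => /orbit_projP[|] /(congr1 fst) /= => [/esym|/esym]; exact: ffX.
Qed.

(** A fixed class would force a point of the punctured plane to be plus or minus i times itself, or
    a point of [X] to be fixed by [tau]. *)
Lemma fixfree_twist : fixfree twist.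
Proof.
move=> y; have [e <-] := twpt_surj y; rewrite twpt_tau => /twpt_eq[|[h _]];
  last first.
  exact: (ffX (esym h)).
case=> _ /= [/esym|h]; first exact: muli_neq.
by apply: (@muli_neq R e.2); rewrite {1}h muli_neg muli_muli negK.
Qed.

Lemma twE_hausdorff : hausdorff_space twE.
Proof.
move=> [x z] [x' z'] h; congr pair.
  by apply: (cluster_image (f := fst : twE -> X) _ hX h) => e; exact: cvg_fst.
by apply: (cluster_image (f := snd : twE ->
  P) _ (@punctured_hausdorff R) h) => e; exact: cvg_snd.
Qed.

Lemma free1 : free_action tw1.
Proof.
apply: sheet_free => x; apply: fixfree_sheet;
  [exact: twE_hausdorff|exact: fixfree1].
Qed.

Lemma hausdorff2 : hausdorff_space tw2.
Proof. exact: (@orbit_hausdorff tw1 twE_hausdorff). Qed.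

Lemma free2 : free_action tw2.
Proof.
apply: sheet_free => x; apply: fixfree_sheet; [exact: hausdorff2|exact: fixfree2].
Qed.

Lemma twist_hausdorff : hausdorff_space twist.
Proof. exact: (@orbit_hausdorff tw2 hausdorff2). Qed.

End Twist.

(** * The coindex *)

Section OddDisc.
Variable R : realType.

Definition disc_set : set (R^o * R^o)%type := [set v | v.1 ^+ 2 + v.2 ^+ 2 <= 1].

Lemma disc_convex (a b : (R^o * R^o)%type) (t : R) : disc_set a -> disc_set b ->
  0 <= t <= 1 -> disc_set (a + t *: (b - a)).
Proof.
move: a b => [a1 a2] [b1 b2]; rewrite /disc_set /= => ha hb /andP[t0 t1].
rewrite -[t *: (b1 - a1)]/(t * (b1 - a1)) -[t *: (b2 - a2)]/(t * (b2 - a2)).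
have h : 2 * (a1 * b1 + a2 * b2) <= a1 ^+ 2 + a2 ^+ 2 + (b1 ^+ 2 + b2 ^+ 2).
  have := sqr_ge0 (a1 - b1); have := sqr_ge0 (a2 - b2); nra.
have -> : (a1 + t * (b1 - a1)) ^+ 2 + (a2 + t * (b2 - a2)) ^+ 2 =
  (1 - t) ^+ 2 * (a1 ^+ 2 + a2 ^+ 2) + t ^+ 2 * (b1 ^+ 2 + b2 ^+ 2) +
  t * (1 - t) * (2 * (a1 * b1 + a2 * b2)) by ring.
have t1' : 0 <= t * (1 - t) by rewrite mulr_ge0// subr_ge0.
have := ler_wpM2l t1' h.
move: ha hb; move: (a1 ^+ 2 + a2 ^+ 2) (b1 ^+ 2 + b2 ^+ 2) (2 * _) => u v w; nra.
Qed.

Lemma disc_compact : compact disc_set.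
Proof.
have -> : disc_set = (`[(-1 : R), 1]%classic `*` `[(-1 : R), 1]%classic) `&`
    (fun v : R^o * R^o => v.1 ^+ 2 + v.2 ^+ 2) @^-1` [set t : R | t <= 1].
  apply/seteqP; split=> [[a b] h|v []//]; split=> //; move: h;
    rewrite /disc_set /= => h.
  have := sqr_ge0 a; have := sqr_ge0 b => hb ha.
  by split; rewrite in_itv /=; apply/andP; split; nra.
apply: compact_closedI.
  by apply: (@compact_setX R^o R^o); exact: segment_compact.
apply: (@preimage_closed (R^o * R^o)%type R (fun v => v.1 ^+ 2 + v.2 ^+ 2));
  last exact: closed_le.
move=> v _; apply: cvgD; rewrite expr2; apply: cvgM;
  solve [exact: cvg_fst|exact: cvg_snd].
Qed.

Definition disc : topologicalType := set_type disc_set.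

Lemma disc_subproof (a b : R) : a ^+ 2 + b ^+ 2 = 1 -> (a, b) \in disc_set.
Proof. by move=> h; apply/mem_set; rewrite /disc_set /= h. Qed.

Definition circle_pt (th : R) : disc :=
  exist (fun v => v \in disc_set) _ (disc_subproof (cos2Dsin2 th)).

Lemma circle_pt_continuous : continuous circle_pt.
Proof.
apply: continuous_comp_initial; rewrite set_valE.
by apply: (@pair_continuous R R^o R^o);
  [exact: continuous_cos|exact: continuous_sin].
Qed.

Lemma circle_pt2pi th : circle_pt (th + pi + pi) = circle_pt th.
Proof.
by apply: val_inj; rewrite /= !cosDpi !sinDpi !opprK.
Qed.

(** What an equivariant map from the 2-sphere leaves on a closed hemisphere. *)
Definition odd_disc (X : Z2space) := exists2 f : disc -> X, continuous f &
  forall th, f (circle_pt (th + pi)) = tau (f (circle_pt th)).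

Lemma twist_odd_disc (X : Z2space) : hausdorff_space X -> fixfree X ->
  odd_disc (twist R X) -> odd_disc X.
Proof.
move=> hX ffX [f cf fodd].
have fX : free_action X by apply: sheet_free => x; exact: fixfree_sheet.
have [f1 cf1 f1E] := lift_convex disc_convex disc_compact (@free2 R X hX ffX) cf.
have [F cF FE] := lift_convex disc_convex disc_compact (@free1 R X hX) cf1.
have FfE d : twpt (F d : twE R X) = f d by rewrite -f1E -FE.
have Fodd th : twpt (twr (F (circle_pt th) : twE R X)) =
    twpt (F (circle_pt (th + pi)) : twE R X).
  by rewrite -twpt_tau !FfE fodd.
pose phi d : X := (F d : twE R X).1; pose zeta d : punctured R := (F d : twE R X).2.
have cphi : continuous phi.
  by move=> d; apply: (@continuous_comp _ (twE R X) _ F fst);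
    [exact: cF|exact: cvg_fst].
have czeta : continuous zeta.
  by move=> d; apply: (@continuous_comp _ (twE R X) _ F snd);
    [exact: cF|exact: cvg_snd].
have cshift : continuous (fun th : R => circle_pt (th + pi)).
  move=> th; apply: (@continuous_comp R R _ (fun th => th + pi) circle_pt).
    by apply: cvgD; [exact: cvg_id|exact: cvg_cst].
  exact: circle_pt_continuous.
have ccomp (Y : topologicalType) (g : disc -> Y) (c : R -> disc) : continuous g ->
    continuous c -> continuous (fun th => g (c th)).
  by move=> cg cc th; apply: (@continuous_comp _ _ _ c g); [exact: cc|exact: cg].
have phiE th : orbit_proj (phi (circle_pt th)) =
  orbit_proj (phi (circle_pt (th + pi))).
  by apply/orbit_projP; have [[]|[]] := twpt_eq (Fodd th); [left|right].
have cp := circle_pt_continuous.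
(* Either [phi] is odd on the whole boundary, and is the disc sought, or it takes equal values at
   opposite boundary points, and [zeta] must account for the involution. *)
have [E|E] := line_lift_unique fX (ccomp _ _ _ cphi cp) (ccomp _ _ _ cphi
  cshift) phiE;
  last by exists phi.
have zE th : zeta (circle_pt (th + pi)) = muli (zeta (circle_pt th)) \/
    zeta (circle_pt (th + pi)) = neg (muli (zeta (circle_pt th))).
  have [[]//|[e _]] := twpt_eq (Fodd th).
  by case: (ffX (phi (circle_pt th))); rewrite -[RHS]E.
pose Pn := involution_space (@negK R) (@neg_continuous R).
have fPn : free_action Pn.
  apply: sheet_free => z; apply: fixfree_sheet; first exact: punctured_hausdorff.
  by move=> w; exact: neg_neq.
have cmz : continuous (fun th => muli (zeta (circle_pt th))).
  move=> th; apply: (@continuous_comp R _ _ (fun th =>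
    zeta (circle_pt th)) (@muli R)).
    exact: (ccomp _ _ _ czeta cp).
  exact: muli_continuous.
have zE' th : @orbit_proj Pn (muli (zeta (circle_pt th))) =
    @orbit_proj Pn (zeta (circle_pt (th + pi))).
  by apply/orbit_projP; case: (zE th) => ->; [left|right].
(* The sign in [zE] is constant around the circle and both square roots of -1 have the same square,
   so a full turn negates [zeta] while returning to the same boundary point. *)
have z2 : zeta (circle_pt (0 + pi + pi)) = neg (zeta (circle_pt 0)).
  have [h|h] := @line_lift_unique R Pn fPn _ _ cmz (ccomp _ _ _ czeta cshift) zE'.
    by rewrite h h muli_muli.
  by rewrite !h /tau /= /inv_act /= muli_neg muli_muli negK.
by case: (@neg_neq R (zeta (circle_pt 0))); rewrite -z2 circle_pt2pi.
Qed.

Lemma negb_continuous : continuous negb.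
Proof. by apply/continuousP => A _; exact: discrete_open. Qed.

Definition two_points := involution_space negbK negb_continuous.

Lemma fixfree_two_points : fixfree two_points.
Proof. by case. Qed.

Lemma two_points_hausdorff : hausdorff_space two_points.
Proof. exact: discrete_hausdorff. Qed.

(** Along the boundary circle a map to two points is constant, hence not odd. *)
Lemma two_points_odd_disc : ~ odd_disc two_points.
Proof.
move=> [f cf fodd].
have fX : free_action two_points.
  apply: sheet_free => x; apply: fixfree_sheet; first exact: two_points_hausdorff.
  exact: fixfree_two_points.
have cfc : continuous (fun th : R => f (circle_pt th)).
  move=> th; apply: (@continuous_comp _ _ _ circle_pt f); last exact: cf.
  exact: circle_pt_continuous.
have cc : continuous (fun _ : R => f (circle_pt 0)) by move=> th; exact: cvg_cst.
have E th : orbit_proj (f (circle_pt 0)) = orbit_proj (f (circle_pt th)).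
  apply/orbit_projP; rewrite involution_tau.
  by case: (f (circle_pt th)) (f (circle_pt 0)) => -[]; [left|right|right|left].
have := fodd 0; rewrite add0r.
have [h|h] := line_lift_unique fX cc cfc E;
  first by rewrite h => /esym/fixfree_two_points.
by have /esym/fixfree_two_points := h 0.
Qed.

Lemma row_sum_continuous (T : topologicalType) m (I : Type) (r : seq I)
    (f : I -> T -> R) (v : I -> 'rV[R]_m) :
  (forall i, continuous (f i)) -> continuous (fun x => \sum_(i <- r) f i x *: v i).
Proof.
move=> cf; apply: (@continuous_big 'rV[R]_m) => [|i _ x];
  first exact: add_continuous.
exact: (@cvgZr_tmp _ _ _ _ (nbhs_filter x) _ _ _ (cf i x)).
Qed.

(* Coordinates of the lift of a disc to the upper hemisphere of S^2 in S^(m+2). *)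
Definition lift_coord (m : nat) (d : disc) (i : 'I_m.+3) : R :=
  match val i with
  | 0 => (val d).1
  | 1 => (val d).2
  | 2 => Num.sqrt (1 - ((val d).1 ^+ 2 + (val d).2 ^+ 2))
  | _ => 0
  end.

Lemma lift_disc_subproof m d : \sum_i lift_coord d i *: delta_mx 0 i \in
  @sphere_set R m.+2.
Proof.
apply/mem_set; rewrite /sphere_set /=.
have E j : (\sum_i @lift_coord m d i *: delta_mx 0 i) 0 j = lift_coord d j :> R.
  rewrite summxE (bigD1 j)//= !mxE !eqxx mulr1 big1 ?addr0// => i ij.
  by rewrite !mxE eq_sym (negbTE ij) mulr0.
under eq_bigr do rewrite E.
rewrite !big_ord_recl big1 => [|i _]; last by rewrite /lift_coord /= expr0n.
rewrite /lift_coord /= sqr_sqrtr; first by ring.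
by rewrite subr_ge0; exact: (set_valP d).
Qed.

Definition lift_disc m d : sphere R m.+2 :=
  exist (fun v => v \in @sphere_set R m.+2) _ (lift_disc_subproof m d).

Lemma disc_coord1_continuous : continuous (fun d : disc => (val d).1).
Proof.
move=> d; apply: (@continuous_comp disc _ R (set_val : disc ->
  (R^o * R^o)%type) fst).
  exact: initial_continuous.
exact: cvg_fst.
Qed.

Lemma disc_coord2_continuous : continuous (fun d : disc => (val d).2).
Proof.
move=> d; apply: (@continuous_comp disc _ R (set_val : disc ->
  (R^o * R^o)%type) snd).
  exact: initial_continuous.
exact: cvg_snd.
Qed.

Lemma lift_disc_continuous m : continuous (lift_disc m).
Proof.
apply: continuous_comp_initial; rewrite set_valE.
apply: row_sum_continuous => -[[|[|[|i]]] /= im]; rewrite /lift_coord /=.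
- exact: disc_coord1_continuous.
- exact: disc_coord2_continuous.
- move=> d; apply: (@continuous_comp disc R R _ Num.sqrt);
  last exact: sqrt_continuous.
  have FF := nbhs_filter d.
  apply: (@cvgB _ R _ (nbhs d) FF); first exact: cvg_cst.
  apply: (@cvgD _ R _ (nbhs d) FF); rewrite expr2; apply: (@cvgM _ _ (nbhs d) FF);
    solve [exact: disc_coord1_continuous|exact: disc_coord2_continuous].
- exact: (@cst_continuous disc R 0).
Qed.

(** The disc is embedded as a hemisphere; on its boundary the third coordinate vanishes, so a half
    turn there is the antipode. *)
Lemma sphere_odd_disc (X : Z2space) m (f : sphere_a R m.+2 -> X) :
  Z2map f -> odd_disc X.
Proof.
move=> [cf ft]; exists (f \o lift_disc m).
  by move=> d; apply: continuous_comp; [exact: lift_disc_continuous|exact: cf].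
move=> th /=; rewrite /tau -ft; congr f; apply: val_inj.
rewrite /= /antipode_val expr1 scaleN1r set_valE /= -sumrN; apply: eq_bigr => i _.
rewrite -scaleNr; congr (_ *: _); rewrite /lift_coord /= cosDpi sinDpi !sqrrN.
rewrite !cos2Dsin2 subrr sqrtr0.
by case: (val i) => [|[|[|?]]]; rewrite ?oppr0.
Qed.

(** The first coordinate spreads [g] over the upper half circle and its translate over the lower
    one; the condition on [g] makes the two agree where the halves meet. *)
Lemma circle_map (X : Z2space) (g : R -> X) : continuous g -> g 1 = tau (g (- 1)) ->
  exists f : sphere_a R 1 -> X, Z2map f.
Proof.
move=> cg g1.
pose a (v : sphere_a R 1) : R := (val v : 'rV[R]_2) 0 ord0.
pose b (v : sphere_a R 1) : R := (val v : 'rV[R]_2) 0 ord_max.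
have ccoord i : continuous (fun v : sphere_a R 1 => (val v : 'rV[R]_2) 0 i).
  move=> v; apply: (@continuous_comp (sphere R 1) _ R (set_val : sphere R 1 ->
    'rV[R]_2) (fun w => w 0 i)).
    exact: initial_continuous.
  exact: coord_continuous.
have ab v : a v ^+ 2 + b v ^+ 2 = 1.
  have := set_mem (valP v); rewrite /sphere_set /= !big_ord_recl big_ord0 addr0.
  by have -> : lift ord0 ord0 = ord_max :> 'I_2 by exact: val_inj.
have cga : continuous (fun v => g (a v)).
  by move=> v; apply: (@continuous_comp _ R _ a g); [exact: ccoord|exact: cg].
have cgb : continuous (fun v => tau (g (- a v))).
  move=> v; apply: (@continuous_comp _ _ _ (fun v => g (- a v)) tau);
    last exact: tau_continuous.
  apply: (@continuous_comp _ R _ (fun v => - a v) g); last exact: cg.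
  by apply: (@cvgN _ R _ (nbhs v) (nbhs_filter v)); exact: ccoord.
have edge v : b v = 0 -> g (a v) = tau (g (- a v)).
  move=> b0; have := ab v; rewrite b0 expr0n addr0 => /eqP.
  by rewrite sqrf_eq1 => /orP[/eqP->//|/eqP->]; rewrite opprK g1 tauK.
exists (fun v => if 0 <= b v then g (a v) else tau (g (- a v))); split.
  by apply: paste_continuous => //; exact: ccoord.
move=> v h; have [->|->] := Z2_cases h; first by rewrite !Z2act0.
have aE : a (Z2act v 1) = - a v.
  by rewrite /a /= /antipode_val expr1 scaleN1r mxE set_valE.
have bE : b (Z2act v 1) = - b v.
  by rewrite /b /= /antipode_val expr1 scaleN1r mxE set_valE.
rewrite aE bE opprK oppr_ge0 -/(tau _).
case: (ltgtP (b v) 0) => [| |b0] //; rewrite ?tauK//.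
by rewrite (edge _ b0) tauK.
Qed.

(** Over a fixed [x], the segment from 2 to 2 i avoids the origin and ends at i times its start,
    that is, at the translate in the twist. *)
Lemma twist_circle (X : Z2space) (x : X) :
  exists f : sphere_a R 1 -> twist R X, Z2map f.
Proof.
have h (t : R) : 0 < (1 - t) ^+ 2 + (1 + t) ^+ 2.
  by have := sqr_ge0 t; rewrite !expr2; nra.
apply: (@circle_map _ (fun t => twpt (x, mkpt (h t)))).
  move=> t; apply: (@continuous_comp R (twE R X) (twist R X) (fun t =>
    (x, mkpt (h t))) (@twpt R X)).
    apply: (@pair_continuous R X (punctured R)); first by move=> ?; exact: cvg_cst.
    apply: mkpt_continuous => s; first by apply: cvgB;
      [exact: cvg_cst|exact: cvg_id].
    by apply: cvgD; [exact: cvg_cst|exact: cvg_id].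
  exact: twpt_continuous.
rewrite twpt_tau; congr (twpt (x, _)); apply: punctured_eq; rewrite !reimE; ring.
Qed.

End OddDisc.

(** * The height *)

Section Quadrants.
Variable R : realFieldType.
Implicit Types a b : R.

(* The boundary is split so that exactly one of any two opposite points has
   value 1. *)
Definition lower a b : 'F_2 :=
  if b < 0 then 1 else if 0 < b then 0 else if a < 0 then 1 else 0.

(** [lower] at the square of the complex number a + b i. *)
Definition lower_sqr a b := lower (a ^+ 2 - b ^+ 2) (2 * (a * b)).

Lemma lower_lt0 a b : b < 0 -> lower a b = 1.
Proof. by rewrite /lower => ->. Qed.
Lemma lower_gt0 a b : 0 < b -> lower a b = 0.
Proof. by rewrite /lower => h; rewrite h ltNge ltW. Qed.
Lemma lower_eq_lt0 a b : b = 0 -> a < 0 -> lower a b = 1.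
Proof. by rewrite /lower => -> ->; rewrite ltxx. Qed.
Lemma lower_eq_gt0 a b : b = 0 -> 0 < a -> lower a b = 0.
Proof. by rewrite /lower => -> h; rewrite ltxx ltNge ltW. Qed.

Lemma F2_add11 : 1 + 1 = 0 :> 'F_2. Proof. exact: val_inj. Qed.

Lemma lower_opp a b : 0 < a ^+ 2 + b ^+ 2 -> lower (- a) (- b) = lower a b + 1.
Proof.
move=> h; case: (ltgtP b 0) => hb.
- by rewrite lower_gt0 ?oppr_gt0// lower_lt0// F2_add11.
- by rewrite lower_lt0 ?oppr_lt0// lower_gt0// add0r.
case: (ltgtP a 0) => ha.
- by rewrite lower_eq_gt0 ?oppr_gt0 ?hb ?oppr0// lower_eq_lt0// F2_add11.
- by rewrite lower_eq_lt0 ?oppr_lt0 ?hb ?oppr0// lower_eq_gt0// add0r.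
by move: h; rewrite ha hb expr0n addr0 ltxx.
Qed.

(** A quarter turn crosses between the half planes exactly from the second and fourth quadrants,
    whose points have their square in the lower half plane. The convention on the boundary makes
    this persist on the axes. *)
Lemma lower_rot a b : 0 < a ^+ 2 + b ^+ 2 ->
  lower (- b) a = lower a b + lower_sqr a b.
Proof.
move=> h; rewrite /lower_sqr; case: (ltgtP a 0) => ha; case: (ltgtP b 0) => hb.
- rewrite (lower_lt0 _ ha) (lower_lt0 _ hb) lower_gt0 ?addr0//; nra.
- rewrite (lower_lt0 _ ha) (lower_gt0 _ hb) lower_lt0 ?add0r//; nra.
- rewrite (lower_lt0 _ ha) (lower_eq_lt0 hb ha) lower_eq_gt0 ?addr0//;
  rewrite hb; nra.
- rewrite (lower_gt0 _ ha) (lower_lt0 _ hb) lower_lt0 ?F2_add11//; nra.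
- rewrite (lower_gt0 _ ha) (lower_gt0 _ hb) lower_gt0 ?addr0//; nra.
- rewrite (lower_gt0 _ ha) (lower_eq_gt0 hb ha) lower_eq_gt0 ?addr0//;
  rewrite hb; nra.
- rewrite (lower_eq_gt0 ha) ?oppr_gt0// (lower_lt0 _ hb) lower_eq_lt0
  ?F2_add11//; rewrite ha; nra.
- rewrite (lower_eq_lt0 ha) ?oppr_lt0// (lower_gt0 _ hb) lower_eq_lt0 ?add0r//;
  rewrite ha; nra.
- by move: h; rewrite ha hb expr0n addr0 ltxx.
Qed.

Lemma lower_sqr_rot a b : 0 < a ^+ 2 + b ^+ 2 ->
  lower_sqr (- b) a = lower_sqr a b + 1.
Proof.
move=> h; rewrite /lower_sqr -lower_opp; last first.
  rewrite (_ : _ + _ = (a ^+ 2 + b ^+ 2) ^+ 2); last by ring.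
  by rewrite exprn_gt0.
congr lower; ring.
Qed.

Lemma lower_sqr_opp a b : lower_sqr (- a) (- b) = lower_sqr a b.
Proof. by rewrite /lower_sqr !sqrrN mulrNN. Qed.

End Quadrants.

Section TwistCohomology.
Variables (R : realType) (X : Z2space).
Hypotheses (hX : hausdorff_space X) (ffX : fixfree X).

Local Notation E := (twE R X).
Local Notation Y := (twist R X).

Lemma fixfree_free (Z : Z2space) : hausdorff_space Z -> fixfree Z -> free_action Z.
Proof. by move=> hZ fZ; apply: sheet_free => z; exact: fixfree_sheet. Qed.

Lemma free_twist : free_action Y.
Proof. exact: (@fixfree_free Y (@twist_hausdorff R X hX) (@fixfree_twist R X
  ffX)). Qed.

Lemma twq_subproof : continuous (fun e : E => orbit_proj (twpt e)).
Proof.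
move=> e; apply: (@continuous_comp E Y _ (@twpt R X) (@orbit_proj Y)).
  exact: twpt_continuous.
exact: orbit_proj_continuous.
Qed.

Definition twpull n (c : cochain R (orbit_space Y) 'F_2 n) : cochain R E 'F_2 n :=
  pull twq_subproof c.

Lemma twpullE n (c : cochain R (orbit_space Y) 'F_2 n) :
  twpull c = pull (@twpt_continuous R X) (pull (@orbit_proj_continuous Y) c).
Proof. by apply/esym; apply: pull_comp. Qed.

Lemma twpt_pullE n (c : cochain R Y 'F_2 n) :
  pull (@twpt_continuous R X) c =
  pull (@orbit_proj_continuous (tw1 R X)) (pull (@orbit_proj_continuous (tw2 R
    X)) c).
Proof. by apply/esym; apply: pull_comp. Qed.

Lemma twpt_pull_inj n : injective (@pull R _ _ _ (@twpt_continuous R X) n).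
Proof.
move=> c d; rewrite !twpt_pullE => /(pull_proj_inj (@free1 R X hX)).
exact: (pull_proj_inj (@free2 R X hX ffX)).
Qed.

Lemma twpull_inj n : injective (@twpull n).
Proof.
move=> c d; rewrite !twpullE => /twpt_pull_inj.
exact: (pull_proj_inj free_twist).
Qed.

(** The cochain descends successively through the three double covers from [E] to the orbit space of
    [Y]; its invariance under [twn] comes from [twn] being the square of [twr]. *)
Lemma tw_descend n (c : cochain R E 'F_2 n) :
  pull (@twr_continuous R X) c = c -> pull (@tws_continuous R X) c = c ->
  exists c', twpull c' = c.
Proof.
move=> cr cs.
have [c1 c1E] : exists c1, pull (@orbit_proj_continuous (tw1 R X)) c1 = c.
  apply: (descend (@free1 R X hX)); rewrite -[RHS]cr -[in RHS]cr; apply/esym.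
  by apply: pull_comp => -[x z]; rewrite /twr /= muli_muli.
have [c2 c2E] : exists c2, pull (@orbit_proj_continuous (tw2 R X)) c2 = c1.
  apply: (descend (@free2 R X hX ffX)); apply: (pull_proj_inj (@free1 R X hX)).
  rewrite c1E -[RHS]cs -c1E.
  have cps : continuous (fun e : tw1 R X => s1 (orbit_proj e)).
    move=> e; apply: (@continuous_comp (tw1 R X) _ _ (@orbit_proj (tw1 R X))
      (@s1 R X)).
      exact: orbit_proj_continuous.
    exact: s1_continuous.
  rewrite (pull_comp _ _ cps _ (fun=> erefl)).
  by apply/esym; apply: pull_comp => e; rewrite s1E.
have [c3 c3E] : exists c3, pull (@orbit_proj_continuous Y) c3 = c2.
  apply: (descend free_twist); apply: twpt_pull_inj.
  have cc : continuous (fun e : E => tau (twpt e)).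
    move=> e; apply: (@continuous_comp E Y Y (@twpt R X) tau).
      exact: twpt_continuous.
    exact: tau_continuous.
  rewrite (pull_comp _ _ cc _ (fun=> erefl)).
  rewrite [RHS]twpt_pullE c2E c1E -cr -c1E -c2E -twpt_pullE.
  by apply/esym; apply: pull_comp => e; rewrite twpt_tau.
by exists c3; rewrite twpullE c3E twpt_pullE c2E.
Qed.

End TwistCohomology.

Section PowerRelation.
Variables (R : realType) (B : topologicalType) (w y : cochain R B 'F_2 1).
Hypotheses (w0 : coboundary w = 0) (y0 : coboundary y = 0).
Hypothesis wy : exact (cupn w (w + y) : cochain R B 'F_2 2).

Lemma exact_addxx n (c : cochain R B 'F_2 n) : exact (c + c).
Proof.
by rewrite cochain_addxx; case: n c => [//|n] c; exists 0; rewrite coboundary0.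
Qed.

(** By induction: multiply by [w], then replace the product of [w] with itself by that of [w] and
    [y]. *)
Lemma cpow_relation k : exact (cpow w k.+1 + cupn w (cpow y k)).
Proof.
elim: k => [|k IH]; first exact: exact_addxx.
apply: (@coh_trans _ _ _ _ (cupn w (cupn w (cpow y k) : cochain R B 'F_2 k.+1))).
  change (exact (cupn w (cpow w k.+1) +
    cupn w (cupn w (cpow y k) : cochain R B 'F_2 k.+1) :
    cochain R B 'F_2 k.+2)).
  by rewrite -cupnDr; exact: exact_cupl.
change (exact (cupn w (cupn w (cpow y k) : cochain R B 'F_2 (1 + k)) +
  cupn w (cupn y (cpow y k) : cochain R B 'F_2 (1 + k)) : cochain R B 'F_2 k.+2)).
rewrite -!(@cupnA _ _ 1 1 k)// -cupnDl -cupnDr.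
case: wy => b <-; apply: exact_cupr => //; exact: cpow_cocycle.
Qed.

Lemma cpow_relation_exact k : exact (cpow y k) -> exact (cpow w k.+1).
Proof.
move=> ey; apply: (exact_coh (c := cupn w (cpow y k))).
  by rewrite addrC; exact: cpow_relation.
exact: exact_cupl.
Qed.

End PowerRelation.

Section TwistHeight.
Variables (R : realType) (X : Z2space).
Hypotheses (hX : hausdorff_space X) (ffX : fixfree X).

Local Notation E := (twE R X).
Local Notation Y := (twist R X).
Local Notation pullr := (pull (@twr_continuous R X)).
Local Notation pulls := (pull (@tws_continuous R X)).

Let fX : free_action X := fixfree_free hX ffX.

Section Functions.
Variable eta : X -> 'F_2.
Hypothesis oeta : odd_function eta.

(* [re e.2] and [im_twist e] are the coordinates of [zeta'], which is [zeta]
   or its conjugate according to [eta]. *)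
Definition im_twist (e : E) : R := if eta e.1 == 0 then im e.2 else - im e.2.
(** Invariant under [tws] and odd under [twr], this becomes an odd function on the twist, and its
    coboundary gives the Stiefel-Whitney cocycle there. *)
Definition fun_w (e : E) : 'F_2 := lower_sqr (re e.2) (im_twist e).
Definition fun_k (e : E) : 'F_2 := lower (re e.2) (im_twist e).
Definition fun_y (e : E) : 'F_2 := eta e.1.

Lemma im_twist_gt0 e : 0 < re e.2 ^+ 2 + im_twist e ^+ 2.
Proof. by rewrite /im_twist; case: ifP => _; rewrite ?sqrrN punctured_gt0. Qed.

Lemma im_twist_s e : im_twist (tws e) = im_twist e.
Proof.
rewrite /im_twist /= oeta reimE; have [->|->] := F2_cases (eta e.1).
  by rewrite add0r eqxx opprK.
by rewrite F2_add11 eqxx.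
Qed.

Lemma fun_w_s e : fun_w (tws e) = fun_w e.
Proof. by rewrite /fun_w im_twist_s /= reimE. Qed.

Lemma fun_k_s e : fun_k (tws e) = fun_k e.
Proof. by rewrite /fun_k im_twist_s /= reimE. Qed.

Lemma fun_y_s e : fun_y (tws e) = fun_y e + 1.
Proof. exact: oeta. Qed.

Lemma fun_w_r e : fun_w (twr e) = fun_w e + 1.
Proof.
have := im_twist_gt0 e; rewrite /fun_w /im_twist /= !reimE.
case: ifP => _ h; first by rewrite lower_sqr_rot.
by rewrite -(lower_sqr_rot h) opprK -[LHS]lower_sqr_opp !opprK.
Qed.

(** Where [eta] is 0, [twr] multiplies the coordinate by i and [lower_rot] applies; where [eta] is
    1, the conjugate is multiplied by -i, and the extra sign accounts for [fun_y]. *)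
Lemma fun_k_r e : fun_k (twr e) = fun_k e + (fun_w e + fun_y e).
Proof.
have := im_twist_gt0 e; rewrite /fun_k /fun_w /fun_y /im_twist /= !reimE.
have [->|->] := F2_cases (eta e.1) => /= h; first by rewrite addr0 lower_rot.
rewrite lower_opp; last by rewrite addrC -[im e.2]opprK sqrrN.
by rewrite addrA -(lower_rot h) opprK.
Qed.

Local Notation Dw := (coboundary (fun0 fun_w) : cochain R E 'F_2 1).
Local Notation Dy := (coboundary (fun0 fun_y) : cochain R E 'F_2 1).
Local Notation Dk := (coboundary (fun0 fun_k) : cochain R E 'F_2 1).

Lemma Dw_r : pullr Dw = Dw.
Proof. by rewrite pull_coboundary pull_fun0; apply: coboundary_fun0_shift => e;
  exact: fun_w_r. Qed.
Lemma Dw_s : pulls Dw = Dw.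
Proof. by rewrite pull_coboundary pull_fun0; congr (coboundary (fun0 _));
  apply/funext => e; exact: fun_w_s. Qed.
Lemma Dy_r : pullr Dy = Dy.
Proof. by rewrite pull_coboundary pull_fun0. Qed.
Lemma Dy_s : pulls Dy = Dy.
Proof. by rewrite pull_coboundary pull_fun0; apply: coboundary_fun0_shift => e;
  exact: fun_y_s. Qed.

(* The first summand has the right coboundary, but [r] changes it by
   [Dw + Dy]; the square root [zeta] of the circle coordinate is there to
   provide a function [fun_k] that [r] changes by [fun_w + fun_y]. *)
Definition relation_cochain : cochain R E 'F_2 1 :=
  cupn (fun0 fun_w) (Dw + Dy) + Dk.

Lemma relation_coboundary :
  coboundary relation_cochain = cupn Dw (Dw + Dy).
Proof.
rewrite /relation_cochain coboundaryD coboundary2_fun0 addr0 (@leibniz _ _ 0 1)//.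
by rewrite coboundaryD !coboundary2_fun0 addr0 cupn0 addr0.
Qed.

Lemma relation_s : pulls relation_cochain = relation_cochain.
Proof.
rewrite /relation_cochain pullD pull_cupn pullD Dw_s Dy_s pull_coboundary
  !pull_fun0.
by congr (cupn (fun0 _) _ + coboundary (fun0 _)); apply/funext => e;
  [exact: fun_w_s|exact: fun_k_s].
Qed.

Lemma relation_r : pullr relation_cochain = relation_cochain.
Proof.
rewrite /relation_cochain pullD pull_cupn pullD Dw_r Dy_r pull_coboundary
  !pull_fun0.
have -> : fun0 (fun_w \o @twr R X) = fun0 fun_w + cst 1 :> cochain R E 'F_2 0.
  by apply/funext => s; exact: fun_w_r.
have -> : fun0 (fun_k \o @twr R X) =
  fun0 fun_k + (fun0 fun_w + fun0 fun_y) :> cochain R E 'F_2 0.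
  by apply/funext => s; exact: fun_k_r.
rewrite cupnDl cup1n !coboundaryD -addrA; congr (_ + _).
by rewrite addrCA cochain_addxx addr0.
Qed.

Lemma fun_w_desc : exists2 f : Y ->
  'F_2, odd_function f & forall e, f (twpt e) = fun_w e.
Proof.
have /choice[g gP] := @twpt_surj R X.
have fE e : fun_w (g (twpt e)) = fun_w e.
  have fn e' : fun_w (twn e') = fun_w e'.
    by rewrite -[twn e']/(e'.1, neg e'.2) -muli_muli -/(twr (twr e')) !fun_w_r
      -addrA F2_add11 addr0.
  move: (g _) (gP (twpt e)) => e' /twpt_eq.
  case: e => x z /=; case: e' => x' z' /= [[-> [->|->]]|[-> [->|->]]] //.
  - by rewrite -(fn (x', z')).
  - by rewrite -(fun_w_s (x', z')).
  - by rewrite -(fun_w_s (x', z')) -(fn (tws _)).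
exists (fun y => fun_w (g y)) => [y|//].
have [e <-] := twpt_surj y; rewrite twpt_tau !fE; exact: fun_w_r.
Qed.

End Functions.

Lemma twist_height_le n : cup_power (sw1 R X) n.+1 = 0 ->
  cup_power (sw1 R Y) n.+2 = 0.
Proof.
have [eta oeta] := odd_function_exists fX.
have [y swy yE] := @sw_cocycle_exists R X fX _ oeta.
have [f of_ fE] := fun_w_desc oeta.
have fY : free_action Y := free_twist hX ffX.
have [w sww wE] := @sw_cocycle_exists R Y fY _ of_.
move=> /(sw1_power fX _ swy) ey; apply/(sw1_power fY _ sww).
(* [y'] is [y] seen on the orbit space of [Y]: the pullback of [y] to [E] is descended. The cochain
   [b] below is the primitive of [cupn w (w + y')]. *)
have [y' y'E] := tw_descend hX ffX (Dy_r eta) (Dy_s oeta).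
have [b bE] := tw_descend hX ffX (relation_r eta) (relation_s oeta).
have inj n := @twpull_inj R X hX ffX n.
have w'E : twpull w = coboundary (fun0 (fun_w eta)).
  rewrite twpullE wE pull_coboundary pull_fun0; congr (coboundary (fun0 _)).
  by apply/funext => e; exact: fE.
have y'0 : coboundary y' = 0.
  apply: inj; rewrite /twpull pull_coboundary -/(twpull y') y'E coboundary2_fun0.
  by apply/funext => s.
apply: (@cpow_relation_exact _ _ w y') => //.
- exact: (sw_cocycle_coboundary fY sww).
- exists b; apply: inj;
  rewrite /twpull pull_coboundary -/(twpull b) bE relation_coboundary.
  by rewrite pull_cupn pullD -!/(twpull _) w'E y'E.
have cp : continuous (fun e : E => orbit_proj e.1).
  move=> e; apply: (@continuous_comp E X _ fst (@orbit_proj X));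
    first exact: cvg_fst.
  exact: orbit_proj_continuous.
have pullcp : pull cp y = coboundary (fun0 (fun_y eta)).
  have cf : continuous (fst : E -> X) by move=> e; exact: cvg_fst.
  by rewrite -(pull_comp cf (@orbit_proj_continuous X) cp _ (fun=> erefl)) yE
    pull_coboundary.
(* A primitive of the power of [y], pulled back to [E], descends to a primitive of the same power of
   [y']. *)
case: ey => c cE.
have [c' c'E] : exists c', twpull c' = pull cp c.
  by apply: (tw_descend hX ffX); apply: pull_comp => e //=; rewrite orbit_proj_tau.
exists c'; apply: inj.
rewrite /twpull pull_coboundary -/(twpull c') c'E -pull_coboundary cE.
by rewrite !pull_cpow -/(twpull y') y'E pullcp.
Qed.

End TwistHeight.

(** A primitive of [a] plus its translate is invariant under [tau], so it descends to a primitive of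
    [d]. *)
Lemma exact_transfer (R : realType) (X : Z2space) (fX : free_action X) n
    (a : cochain R X 'F_2 n) (d : cochain R (orbit_space X) 'F_2 n) :
  exact a -> pull (@orbit_proj_continuous X) d = a + pull (@tau_continuous X) a ->
  exact d.
Proof.
case: n a d => [|n] a d /=.
  by move=> -> dE; apply: (pull_proj_inj fX); rewrite dE; apply/funext => s;
    exact: addr0.
move=> [b <-] dE.
have [b' b'E] : exists b', pull (@orbit_proj_continuous X) b' =
  b + pull (@tau_continuous X) b.
  apply: (descend fX); rewrite pullD addrC; congr (_ + _).
  apply/funext => s; rewrite /pull; congr b.
  by apply: singular_eq => x /=; rewrite tauK.
exists b'; apply: (pull_proj_inj fX).
by rewrite pull_coboundary b'E dE coboundaryD pull_coboundary.
Qed.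

Section TwistNonvanishing.
Variables (R : realType) (X : Z2space).
Hypotheses (hX : hausdorff_space X) (ffX : fixfree X).

Local Notation Y := (twist R X).

Lemma line_subproof (t : R) : 0 < 1 ^+ 2 + t ^+ 2.
Proof. by have := sqr_ge0 t; rewrite expr1n; lra. Qed.

Definition section_homotopy (xt : X * R) : Y :=
  twpt (xt.1, mkpt (line_subproof xt.2)).

Lemma section_homotopy_continuous : continuous section_homotopy.
Proof.
move=> xt; apply: (@continuous_comp (X * R)%type (twE R X) Y
  (fun xt => (xt.1, mkpt (line_subproof xt.2))) (@twpt R X)).
  apply: (@pair_continuous (X * R)%type X (punctured R)); first by move=> ?;
    exact: cvg_fst.
  by apply: mkpt_continuous => ?; [exact: cvg_cst|exact: cvg_snd].
exact: twpt_continuous.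
Qed.

Definition section0 (x : X) := section_homotopy (x, 0).
Definition section1 (x : X) := section_homotopy (x, 1).

Lemma section_continuous t : continuous (fun x => section_homotopy (x, t)).
Proof.
move=> x; apply: (@continuous_comp X (X * R)%type Y (fun x =>
  (x, t)) section_homotopy).
  by apply: (@pair_continuous X X R) => ?; [exact: cvg_id|exact: cvg_cst].
exact: section_homotopy_continuous.
Qed.

(** Conjugation fixes (1, 0). *)
Lemma section0_tau x : section0 (tau x) = section0 x.
Proof.
transitivity (twpt (tws (x, mkpt (line_subproof 0) : punctured R) : twE R X)).
  apply: (congr1 (@twpt R X)); apply: (congr1 (pair (tau x))).
  by apply: punctured_eq; rewrite !reimE ?oppr0.
exact: twpt_s.
Qed.

(** Conjugation sends 1 + i to 1 - i, which is minus i times 1 + i. *)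
Lemma section1_tau x : section1 (tau x) = tau (section1 x).
Proof.
rewrite [RHS]twpt_tau; set e := twr _.
transitivity (twpt (tws (twn e) : twE R X)); last by rewrite twpt_s twpt_n.
apply: (congr1 (@twpt R X)); apply: (congr1 (pair (tau x))).
by apply: punctured_eq; rewrite !reimE ?opprK.
Qed.

Local Notation sec0 := (@section_continuous 0 : continuous section0).
Local Notation sec1 := (@section_continuous 1 : continuous section1).

Lemma twist_height_ge n : cup_power (sw1 R Y) n.+1 = 0 -> cup_power (sw1 R X) n = 0.
Proof.
have fX := fixfree_free hX ffX; have fY := free_twist hX ffX : free_action Y.
have [e oe] := odd_function_exists fY.
have [w sww wE] := @sw_cocycle_exists R Y fY _ oe.
(* With this odd function on [X], the pullback of [De] along [section1] equals the pullback of [y]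
   as a cochain, and not only up to a coboundary. *)
have oe1 : odd_function (e \o section1) by move=> x; rewrite /= section1_tau oe.
have [y swy yE] := @sw_cocycle_exists R X fX _ oe1.
move=> /(sw1_power fY _ sww)[b bE]; apply/(sw1_power fX _ swy).
set De : cochain R Y 'F_2 1 := coboundary (fun0 e).
pose c : cochain R Y 'F_2 n :=
  cupn (fun0 e) (cpow De n) + pull (@orbit_proj_continuous Y) b.
have De0 : coboundary De = 0 by exact: coboundary2_fun0.
have c0 : coboundary c = 0.
  rewrite coboundaryD (@leibniz _ _ 0 n)// cpow_cocycle// cupn0 addr0.
  have -> : coboundary (pull (@orbit_proj_continuous Y) b) = cpow De n.+1.
    apply: (etrans (esym (pull_coboundary (@orbit_proj_continuous Y) b))).
    have bE' := congr1 (@pull R Y (orbit_space Y) _ (@orbit_proj_continuous Y)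
      n.+1) bE.
    apply: (etrans bE').
    apply: (etrans (@pull_cpow R Y _ _ (@orbit_proj_continuous Y) w n.+1)).
    exact: (congr1 (fun v => cpow v n.+1) wE).
  exact: (cochain_addxx (cpow De n.+1)).
have h := homotopy_exact section_homotopy_continuous sec0 sec1
  (fun=> erefl) (fun=> erefl) c0.
(* Adding the translate cancels the pullback along [section0], which is invariant, and that of [b]
   along [section1], which factors through the orbit space. As [e] is odd, the pullback of
   [cpow y n] remains. *)
apply: (exact_transfer fX h).
rewrite pullD.
have -> : pull (@tau_continuous X) (pull sec0 c) = pull sec0 c.
  by apply: pull_comp => x; rewrite section0_tau.
rewrite addrACA cochain_addxx add0r pull_cpow yE.
rewrite /c !pullD !pull_cupn !pull_fun0 !pull_cpow.
have -> : pull sec1 De = coboundary (fun0 (e \o section1)).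
  by rewrite pull_coboundary pull_fun0.
rewrite (odd_coboundary R oe1).
have -> : pull (@tau_continuous X) (pull sec1 (pull (@orbit_proj_continuous Y) b)) =
    pull sec1 (pull (@orbit_proj_continuous Y) b).
  have cc : continuous (fun x => orbit_proj (section1 x)).
    move=> x; apply: (@continuous_comp X Y _ section1 (@orbit_proj Y)).
      exact: sec1.
    exact: orbit_proj_continuous.
  rewrite (pull_comp sec1 (@orbit_proj_continuous Y) cc _ (fun=> erefl)).
  by apply: pull_comp => x; rewrite section1_tau orbit_proj_tau.
rewrite addrACA cochain_addxx addr0 -cupnDl.
have -> : fun0 (e \o section1) + fun0 ((e \o section1) \o tau) =
  cst 1 :> cochain R X 'F_2 0.
  apply/funext => s; rewrite cochainDE /fun0 /= section1_tau oe addrA F2_addxx.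
  exact: add0r.
by rewrite cup1n.
Qed.

End TwistNonvanishing.

(** * The tower and its invariants *)

Section Tower.
Variable R : realType.

Fixpoint tower (n : nat) : Z2space :=
  match n with
  | 0 => two_points
  | n'.+1 => twist R (tower n')
  end.

Lemma tower_hausdorff n : hausdorff_space (tower n).
Proof. by elim: n => [|n IH];
  [exact: two_points_hausdorff|exact: twist_hausdorff]. Qed.

Lemma tower_fixfree n : fixfree (tower n).
Proof. by elim: n => [|n IH]; [exact: fixfree_two_points|exact: fixfree_twist]. Qed.

Lemma tower_free n : free_action (tower n).
Proof. exact: (fixfree_free (@tower_hausdorff n) (@tower_fixfree n)). Qed.

Lemma tower_inhabited n : exists x : tower n, True.
Proof.
elim: n => [|n [x _]]; first by exists true.
by exists (section0 R x).
Qed.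

Lemma tower_odd_disc n : ~ odd_disc R (tower n).
Proof.
elim: n => [|n IH]; first exact: two_points_odd_disc.
by move=> /(twist_odd_disc (@tower_hausdorff n) (@tower_fixfree n)).
Qed.

Lemma two_points_line (g : R -> two_points) t : continuous g -> g t = g 0.
Proof.
move=> cg; have fX := @tower_free 0 : free_action two_points.
have E s : orbit_proj (g s) = orbit_proj (g 0).
  apply/orbit_projP; rewrite involution_tau.
  by case: (g s) (g 0) => -[]; [left|right|right|left].
have [h//|h] := line_lift_unique fX cg (fun _ => cvg_cst _) E.
by have /esym/fixfree_two_points := h 0.
Qed.

Lemma two_points_power0 : cup_power (sw1 R two_points) 0 <> 0.
Proof.
have fX := @tower_free 0 : free_action two_points.
have [e oe] := odd_function_exists fX.
have [y swy _] := @sw_cocycle_exists R two_points fX _ oe.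
move=> /(sw1_power fX _ swy) /=.
pose s : singular R (orbit_space two_points) 0 :=
  exist _ (cst (orbit_proj (true : two_points))) (@cst_continuous _ _ _).
by move=> /(congr1 (@^~ s)) /eqP; vm_compute.
Qed.

(** Paths in two points are constant, so the Stiefel-Whitney cocycle itself vanishes. *)
Lemma two_points_power1 : cup_power (sw1 R two_points) 1 = 0.
Proof.
have fX := @tower_free 0 : free_action two_points.
have [e oe] := odd_function_exists fX.
have [y swy yE] := @sw_cocycle_exists R two_points fX _ oe.
apply/(sw1_power fX _ swy).
have -> : y = 0.
  apply: (pull_proj_inj fX); rewrite yE; apply/funext => s; rewrite coboundary_fun0.
  have -> : path1 s = path0 s.
    rewrite /path1 /path0.
    have := two_points_line 1 (@path_line_continuous R two_points s).
    by rewrite /path_line segment0 segment1.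
  exact: F2_addxx.
by exists 0; rewrite coboundary0 /= cup0n.
Qed.

Lemma tower_power n :
  cup_power (sw1 R (tower n)) n <> 0 /\ cup_power (sw1 R (tower n)) n.+1 = 0.
Proof.
elim: n => [|n [h0 h1]]; first by split;
  [exact: two_points_power0|exact: two_points_power1].
split; last exact: (twist_height_le (@tower_hausdorff n) (@tower_fixfree n)).
by move/(twist_height_ge (@tower_hausdorff n) (@tower_fixfree n)).
Qed.

Lemma tower_height n : sw_height R (tower n) = n%:R%:E.
Proof.
have [h0 h1] := tower_power n.
have fX := @tower_free n.
have [e oe] := odd_function_exists fX.
have [y swy yE] := @sw_cocycle_exists R (tower n) fX _ oe.
have y0 := sw_cocycle_coboundary fX swy.
(* Multiplication by the cocycle [y] preserves exactness, so the vanishing in degree [n.+1] passes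
   to all higher powers. *)
have vanish m : (n < m)%N -> cup_power (sw1 R (tower n)) m = 0.
  move=> nm; apply/(sw1_power fX _ swy); rewrite -(subnKC nm).
  elim: (m - _)%N => [|k IH]; first by rewrite addn0; apply/(sw1_power fX _ swy).
  by rewrite addnS; exact: (exact_cupl y0 IH).
apply/eqP; rewrite eq_le; apply/andP; split.
  apply: ge_ereal_sup => _ [m /= hm <-]; rewrite lee_fin ler_nat leqNgt.
  by apply/negP => /vanish hm'; rewrite hm' eqxx in hm.
apply: ereal_sup_ubound; exists n => //=; exact/eqP.
Qed.

Lemma coind_eq1 (X : Z2space) : (exists f : sphere_a R 1 -> X, Z2map f) ->
  ~ odd_disc R X -> coind R X = 1%:R%:E.
Proof.
move=> X1 noX; apply/eqP; rewrite eq_le; apply/andP; split.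
  apply: ge_ereal_sup => _ [[|[|m]] /= [f Zf] <-]; rewrite lee_fin ler_nat//.
  by case: noX; exact: (sphere_odd_disc Zf).
by apply: ereal_sup_ubound; exists 1%N.
Qed.

Lemma tower_coind n : coind R (tower n.+1) = 1%:R%:E.
Proof.
apply: coind_eq1; last exact: tower_odd_disc.
by have [x _] := tower_inhabited n; exact: twist_circle.
Qed.

End Tower.

Theorem theorem1p1 (R : realType) (n : nat) :
  (0 < n)%N ->
  exists X : Z2space,
    [/\ free_action X, sw_height R X = n%:R%:E & coind R X = 1%:R%:E].
Proof.
(* The height is the index of the stage; a positive index makes the stage a twist, which receives an
   equivariant circle. *)
case: n => // n _; exists (tower R n.+1); split.
- exact: tower_free.
- exact: tower_height.
- exact: tower_coind.
Qed.
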